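(* Consider the problem $\min_{x,z} F(x)+\phi(z)$ subject to $A(x)+Qz=0$, where $A$ is a multi-affine quadratic operator with coefficients $C_i,d_i,e_i$ ($i=1,\dots,n_c$). Suppose that $F$ is subanalytic and $F(x)=f(x)+\sum_{i=1}^n I_i(x_i)$, where $f$ is $C^2$, $\mu_f$-strongly convex and $L_f$-smooth and $I_i$ is the indicator function of a nonempty closed convex set $X_i\subseteq\mathbb{R}^{n_i}$; that $\phi$ is $C^2$, $\mu_\phi$-strongly convex and $L_\phi$-smooth; that $Q\in\mathbb{R}^{n_c\times n_z}$ has full row rank; and that $$\rho\ \ge\ \max\Big\{\frac{4L_\phi^2}{\mu_\phi\,\lambda_{\min}^+(Q^TQ)},\ \frac{4L_\phi^2}{\mu_\phi\sqrt{\lambda_{\min}^+(QQ^T)}}\Big\}.$$ Then there exist constants $m_1,m_2,m_3>0$, depending only on the parameters of the problem and algorithm other than the matrices $C_i$ (such as $L_f,\mu_f,L_\phi,\mu_\phi,n_c$, the $d_i$, the $e_i$, the minimizers of $f$ and $\phi$, and the initialization), such that the following holds. Write $\|C\|:=\max_i\|C_i\|$, let $(x^k,z^k,w^k)$ be the iterates of ADMM with penalty parameter $\rho$, and let $(x^\star,z^\star,w^\star)$ be their limit point. If $$\|C\|\le\|(QQ^T)^{-1}Q\|^{-1}\min\Big\{m_1,\ m_2\,(\lambda_{\min}(QQ^T))^{\frac12},\ m_3\,(\lambda_{\min}(QQ^T))^{\frac14}\|(QQ^T)^{-1}Q\|^{\frac12}\Big\}$$ and the augmented Lagrangian $L$ is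 second-order differentiable at $(x^\star,z^\star,w^\star)$, then there exists $c_1>1$ such that $$L(x^k,z^k,w^k)-L(x^\star,z^\star,w^\star)\in\mathcal{O}(c_1^{-k}).$$ Furthermore, $(x^\star,z^\star)$ is a local minimum of the problem $\min_{x,z}F(x)+\phi(z)$ subject to $A(x)+Qz=0$.
   Context: Variables: $x=(x_1,\dots,x_n)\in\mathbb{R}^{n_x}$ is partitioned into $n$ blocks $x_i\in\mathbb{R}^{n_i}$; $x_{-i}$ denotes all blocks except the $i$-th, and $x_{i:j}=(x_i,\dots,x_j)$ if $j\ge i$ (empty if $j<i$). $z\in\mathbb{R}^{n_z}$, $w\in\mathbb{R}^{n_c}$. Multi-affine quadratic operator: $A:\mathbb{R}^{n_x}\to\mathbb{R}^{n_c}$ such that for each $i\in\{1,\dots,n_c\}$ there are $C_i\in\mathbb{R}^{n_x\times n_x}$, $d_i\in\mathbb{R}^{n_x}$, $e_i\in\mathbb{R}$ with $(A(x))_i=\frac12x^TC_ix+d_i^Tx+e_i$, and moreover for every block index $j$ and every fixed $x_{-j}$, the map $x_j\mapsto A(x_j;x_{-j})$ is affine. The indicator of a set takes value $0$ on the set and $+\infty$ outside. A function $g$ is $L$-smooth if $\|\nabla g(x)-\nabla g(x')\|\le L\|x-x'\|$ for all $x,x'$. A function is subanalytic if its graph is a subanalytic set. $\|M\|$ is the spectral norm of a matrix $M$; $\lambda_{\min}(M)$ and $\lambda_{\min}^+(M)$ are its smallest and smallest positive eigenvalues. Augmented Lagrangian with parameter $\rho>0$: $L(x,z,w)=F(x)+\phi(z)+\langle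 w,A(x)+Qz\rangle+\frac{\rho}{2}\|A(x)+Qz\|^2$. ADMM: given an initial point $(x^0,z^0,w^0)$ and $\rho$, for $k=0,1,2,\dots$: for $i=1,\dots,n$ in order, $x_i^{k+1}\in\arg\min_{x_i}L(x_{1:i-1}^{k+1},x_i,x_{i+1:n}^k,z^k,w^k)$; then $z^{k+1}\in\arg\min_zL(x^{k+1},z,w^k)$; then $w^{k+1}=w^k+\rho(A(x^{k+1})+Qz^{k+1})$. *)

(* Defs.v *)
From HB Require Import structures.
From mathcomp Require Import all_boot all_order all_algebra.
From mathcomp Require Import all_classical all_reals all_analysis.

Set Implicit Arguments.
Unset Strict Implicit.
Unset Printing Implicit Defensive.

Import Order.TTheory GRing.Theory Num.Theory.
Import numFieldNormedType.Exports.

Local Open Scope classical_set_scope.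
Local Open Scope ring_scope.

Section Euclidean.
Context {R : realType}.

Definition dot m (u v : 'cV[R]_m) : R := (u^T *m v) 0 0.

(* The library norm `|v| on matrices is the max norm; it induces the same
   topology (and hence the same notions of closed, bounded and differentiable),
   but quantitative estimates need the Euclidean norm. *)
Definition enorm m (v : 'cV[R]_m) : R := Num.sqrt (dot v v).

Definition spectral_norm m p (M : 'M[R]_(m, p)) : R :=
  sup [set enorm (M *m v) | v in [set v : 'cV[R]_p | enorm v <= 1]].

(* For the symmetric matrices below these sets of real eigenvalues are finite
   and nonempty, so that the infima are minima. *)
Definition lambda_min m (M : 'M[R]_m) : R := inf [set a | eigenvalue M a].
Definition lambda_min_pos m (M : 'M[R]_m) : R :=
  inf [set a | eigenvalue M a /\ 0 < a].

End Euclidean.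

Section Regularity.
Context {R : realType}.

(* The domains are finite dimensional, so regularity of the derivative map can
   be tested on each direction separately. *)
Definition C2 (V : normedModType R) (g : V -> R) : Prop :=
  [/\ forall x, differentiable g x,
      forall u x, differentiable (fun y => 'd g y u : R) x
    & forall u v, continuous (fun x => 'd (fun y => 'd g y u : R) x v : R)].

Definition twice_differentiable_at (V : normedModType R) (g : V -> \bar R)
    (p : V) : Prop :=
  [/\ \forall q \near p, g q \is a fin_num,
      \forall q \near p, differentiable (fine \o g) q
    & forall u, differentiable (fun q => 'd (fine \o g) q u : R) p].

Definition gradient m (g : 'cV[R]_m -> R) (x : 'cV[R]_m) : 'cV[R]_m :=
  \col_i ('d g x (delta_mx i 0) : R).

Definition smooth m (L : R) (g : 'cV[R]_m -> R) : Prop :=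
  forall x x', enorm (gradient g x - gradient g x') <= L * enorm (x - x').

Definition strongly_convex m (mu : R) (g : 'cV[R]_m -> R) : Prop :=
  forall (x y : 'cV[R]_m) (t : R), 0 <= t <= 1 ->
    g (t *: x + (1 - t) *: y) <=
      t * g x + (1 - t) * g y - mu / 2 * t * (1 - t) * enorm (x - y) ^+ 2.

End Regularity.

Section Subanalytic.
Context {R : realType}.

(* Near a, g is the sum of an absolutely convergent power series
   \sum_alpha c_alpha (x - a)^alpha over multi-indices alpha; being absolutely
   convergent, it may be summed along the boxes {0, ..., k-1}^m. *)
Definition analytic_at m (g : 'cV[R]_m -> R) (a : 'cV[R]_m) : Prop :=
  exists (c : ('I_m -> nat) -> R) (r : R), 0 < r /\
    forall x : 'cV[R]_m, enorm (x - a) < r ->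
      let term (alpha : 'I_m -> nat) :=
        c alpha * \prod_(i < m) (x i 0 - a i 0) ^+ alpha i in
      cvgn (fun k : nat =>
        \sum_(alpha : {ffun 'I_m -> 'I_k}) `|term (fun i => alpha i)|) /\
      (fun k : nat =>
        \sum_(alpha : {ffun 'I_m -> 'I_k}) term (fun i => alpha i)) @ \oo
        --> g x.

Definition semianalytic m (S : set 'cV[R]_m) : Prop :=
  forall a : 'cV[R]_m, exists V : set 'cV[R]_m, open_nbhs a V /\
    exists (p q : nat) (f g : 'I_p -> 'I_q -> 'cV[R]_m -> R),
      (forall i j x, V x -> analytic_at (f i j) x /\ analytic_at (g i j) x) /\
      S `&` V = [set x | V x /\
        exists i, forall j, f i j x = 0 /\ 0 < g i j x].

Definition subanalytic_set m (S : set 'cV[R]_m) : Prop :=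
  forall a : 'cV[R]_m, exists V : set 'cV[R]_m, open_nbhs a V /\
    exists (p : nat) (B : set 'cV[R]_(m + p)),
      [/\ bounded_set B, semianalytic B
        & S `&` V = [set x | exists y : 'cV[R]_p, B (col_mx x y)]].

(* The graph of an extended-real-valued function is taken in R^m x R: points
   with infinite value contribute nothing. *)
Definition subanalytic m (F : 'cV[R]_m -> \bar R) : Prop :=
  subanalytic_set
    [set p : 'cV[R]_(m + 1) | F (usubmx p) = (dsubmx p 0 0)%:E].

End Subanalytic.

Section Blocks.
Context {R : realType} {n : nat} {nb : 'I_n -> nat}.

(* Block i of x : 'cV_(\sum_i nb i) is submxcol x i. *)

Definition set_block (x : 'cV[R]_(\sum_i nb i)) (j : 'I_n)
    (v : 'cV[R]_(nb j)) : 'cV[R]_(\sum_i nb i) :=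
  \mxcol_i dfwith (fun k => submxcol x k) j v i.

(* Blocks before i are those of x', the others are those of x. *)
Definition mix_blocks (x' x : 'cV[R]_(\sum_i nb i)) (i : 'I_n) :
    'cV[R]_(\sum_i nb i) :=
  \mxcol_j (if (j < i)%N then submxcol x' j else submxcol x j).

Definition indicator (T : Type) (X : set T) (x : T) : \bar R :=
  if x \in X then 0%E else +oo%E.

Definition composite (f : 'cV[R]_(\sum_i nb i) -> R)
    (X : forall i : 'I_n, set 'cV[R]_(nb i)) (x : 'cV[R]_(\sum_i nb i)) :
    \bar R :=
  ((f x)%:E + \sum_(i < n) indicator (X i) (submxcol x i))%E.

Definition affine_map m p (g : 'cV[R]_m -> 'cV[R]_p) : Prop :=
  exists (M : 'M[R]_(p, m)) (b : 'cV[R]_p), forall v, g v = M *m v + b.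

Definition quadratic_op nc (C : 'I_nc -> 'M[R]_(\sum_i nb i))
    (d : 'I_nc -> 'cV[R]_(\sum_i nb i)) (e : 'I_nc -> R)
    (x : 'cV[R]_(\sum_i nb i)) : 'cV[R]_nc :=
  \col_i (2^-1 * dot x (C i *m x) + dot (d i) x + e i).

Definition multiaffine nc (A : 'cV[R]_(\sum_i nb i) -> 'cV[R]_nc) : Prop :=
  forall (j : 'I_n) (x : 'cV[R]_(\sum_i nb i)),
    affine_map (fun v : 'cV[R]_(nb j) => A (set_block x v)).

End Blocks.

Section ADMM.
Context {R : realType} {n : nat} {nb : 'I_n -> nat} {nz nc : nat}.
Variables (F : 'cV[R]_(\sum_i nb i) -> \bar R) (phi : 'cV[R]_nz -> R).
Variables (A : 'cV[R]_(\sum_i nb i) -> 'cV[R]_nc) (Q : 'M[R]_(nc, nz)).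
Variable rho : R.

Definition auglag (x : 'cV[R]_(\sum_i nb i)) (z : 'cV[R]_nz)
    (w : 'cV[R]_nc) : \bar R :=
  (F x + (phi z + dot w (A x + Q *m z)
          + rho / 2 * enorm (A x + Q *m z) ^+ 2)%:E)%E.

(* As usual for extended-real-valued objectives, a function which is
   identically +oo has no minimizer. *)
Definition argmin (T : Type) (g : T -> \bar R) : set T :=
  [set v | (g v < +oo)%E /\ forall u, (g v <= g u)%E].

Definition admm_iterates (x0 : 'cV[R]_(\sum_i nb i)) (z0 : 'cV[R]_nz)
    (w0 : 'cV[R]_nc) (x : nat -> 'cV[R]_(\sum_i nb i))
    (z : nat -> 'cV[R]_nz) (w : nat -> 'cV[R]_nc) : Prop :=
  [/\ x 0%N = x0, z 0%N = z0, w 0%N = w0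
    & forall k : nat,
      [/\ forall i : 'I_n,
            argmin (fun v : 'cV[R]_(nb i) =>
                auglag (set_block (mix_blocks (x k.+1) (x k) i) v) (z k) (w k))
              (submxcol (x k.+1) i),
          argmin (fun u => auglag (x k.+1) u (w k)) (z k.+1)
        & w k.+1 = w k + rho *: (A (x k.+1) + Q *m z k.+1)]].

Definition local_minimum (xs : 'cV[R]_(\sum_i nb i)) (zs : 'cV[R]_nz) : Prop :=
  [/\ (F xs < +oo)%E,
      A xs + Q *m zs = 0
    & \forall p \near (xs, zs), A p.1 + Q *m p.2 = 0 ->
        (F xs + (phi zs)%:E <= F p.1 + (phi p.2)%:E)%E].

End ADMM.

(* Main.v *)
(** Along the iterates [Q^T w^k = - grad phi(z^k)] for [k >= 1], so a dual step is
    controlled by the [z]-step before it, and for [rho] as large as assumed the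
    augmented Lagrangian decreases by a multiple of
    [|x^{k+1} - x^k|^2 + |z^{k+1} - z^k|^2]. On the same set of triples it
    dominates [f + phi] up to constants, hence is coercive: the iterates stay in a
    ball whose radius does not depend on [C] as long as the [C_i] have norm at
    most 1. If in addition the [C_i] are small compared with the radius, the
    curvature of [x |-> <w^k, A x>] is absorbed by the strong convexity of [f], so
    that the Lagrangian with multiplier [w^{k+1}] is convex. Its value at a
    feasible point [(x, z)] is [f x + phi z], whence, with [L_k] the augmented
    Lagrangian at the [k]-th iterate,
      [L_{k+1} - K (L_k - L_{k+1}) <= f x + phi z]
    for every feasible [(x, z)]. At the limit point this contraction inequality
    gives the linear rate; letting [k] tend to infinity in it shows that the limit
    point is even a global minimum. *)

Require Import Defs.
From HB Require Import structures.
From mathcomp Require Import all_boot all_order all_algebra.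
From mathcomp Require Import all_classical all_reals all_analysis.
From mathcomp Require Import ring lra.

Set Implicit Arguments.
Unset Strict Implicit.
Unset Printing Implicit Defensive.

Import Order.TTheory GRing.Theory Num.Theory.
Import numFieldNormedType.Exports.

Local Open Scope classical_set_scope.
Local Open Scope ring_scope.

(** * Euclidean inner product and norm, and the spectral norm *)

Section EuclideanTheory.
Context {R : realType}.
Implicit Types m p : nat.

Lemma dotE m (u v : 'cV[R]_m) : dot u v = \sum_i u i 0 * v i 0.
Proof. by rewrite /dot mxE; apply: eq_bigr => i _; rewrite mxE. Qed.

Lemma dotC m (u v : 'cV[R]_m) : dot u v = dot v u.
Proof. by rewrite !dotE; apply: eq_bigr => i _; rewrite mulrC. Qed.

Lemma dotDr m (u v w : 'cV[R]_m) : dot u (v + w) = dot u v + dot u w.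
Proof. by rewrite /dot mulmxDr mxE. Qed.

Lemma dotDl m (u v w : 'cV[R]_m) : dot (u + v) w = dot u w + dot v w.
Proof. by rewrite dotC dotDr !(dotC w). Qed.

Lemma dotZr m (a : R) (u v : 'cV[R]_m) : dot u (a *: v) = a * dot u v.
Proof. by rewrite /dot -scalemxAr mxE. Qed.

Lemma dotZl m (a : R) (u v : 'cV[R]_m) : dot (a *: u) v = a * dot u v.
Proof. by rewrite dotC dotZr dotC. Qed.

Lemma dotNr m (u v : 'cV[R]_m) : dot u (- v) = - dot u v.
Proof. by rewrite -scaleN1r dotZr mulN1r. Qed.

Lemma dotNl m (u v : 'cV[R]_m) : dot (- u) v = - dot u v.
Proof. by rewrite dotC dotNr dotC. Qed.

Lemma dotBr m (u v w : 'cV[R]_m) : dot u (v - w) = dot u v - dot u w.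
Proof. by rewrite dotDr dotNr. Qed.

Lemma dotBl m (u v w : 'cV[R]_m) : dot (u - v) w = dot u w - dot v w.
Proof. by rewrite dotDl dotNl. Qed.

Lemma dot0r m (u : 'cV[R]_m) : dot u 0 = 0.
Proof. by rewrite -(scale0r (0 : 'cV_m)) dotZr mul0r. Qed.

Lemma dot0l m (u : 'cV[R]_m) : dot 0 u = 0.
Proof. by rewrite dotC dot0r. Qed.

Lemma dot_mulmxr m p (M : 'M[R]_(m, p)) u v : dot u (M *m v) = dot (M^T *m u) v.
Proof. by rewrite /dot trmx_mul trmxK mulmxA. Qed.

Lemma dot_sumr m (I : finType) (u : 'cV[R]_m) (v : I -> 'cV[R]_m) :
  dot u (\sum_i v i) = \sum_i dot u (v i).
Proof. by rewrite /dot mulmx_sumr summxE. Qed.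

Lemma dot_ge0 m (u : 'cV[R]_m) : 0 <= dot u u.
Proof. by rewrite dotE sumr_ge0// => i _; rewrite -expr2 sqr_ge0. Qed.

Lemma enorm_ge0 m (u : 'cV[R]_m) : 0 <= enorm u.
Proof. exact: sqrtr_ge0. Qed.
Hint Resolve enorm_ge0 : core.

Lemma enorm_sqr m (u : 'cV[R]_m) : enorm u ^+ 2 = dot u u.
Proof. by rewrite sqr_sqrtr// dot_ge0. Qed.

Lemma enormZ m (a : R) (u : 'cV[R]_m) : enorm (a *: u) = `|a| * enorm u.
Proof.
by rewrite /enorm dotZl dotZr mulrA -expr2 sqrtrM ?sqr_ge0// sqrtr_sqr.
Qed.

Lemma enormN m (u : 'cV[R]_m) : enorm (- u) = enorm u.
Proof. by rewrite -scaleN1r enormZ normrN1 mul1r. Qed.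

Lemma enorm0 m : enorm (0 : 'cV[R]_m) = 0.
Proof. by rewrite /enorm dot0r sqrtr0. Qed.

Lemma enorm_eq0 m (u : 'cV[R]_m) : (enorm u == 0) = (u == 0).
Proof.
apply/eqP/eqP => [u0|->]; last exact: enorm0.
have : dot u u == 0 by rewrite -enorm_sqr u0 expr0n.
rewrite dotE psumr_eq0 => [/allP h|i _]; last by rewrite -expr2 sqr_ge0.
apply/matrixP => i j; rewrite (ord1 j) mxE.
have /eqP := h i (mem_index_enum _); rewrite -expr2 => /eqP.
by rewrite sqrf_eq0 => /eqP.
Qed.

Lemma enormB m (u v : 'cV[R]_m) : enorm (u - v) = enorm (v - u).
Proof. by rewrite -enormN opprB. Qed.

Lemma enormD_sqr m (u v : 'cV[R]_m) :
  enorm (u + v) ^+ 2 = enorm u ^+ 2 + 2 * dot u v + enorm v ^+ 2.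
Proof. by rewrite !enorm_sqr dotDl !dotDr (dotC v u); lra. Qed.

Lemma dot_le_enorm m (u v : 'cV[R]_m) : `|dot u v| <= enorm u * enorm v.
Proof.
suff h (u' v' : 'cV[R]_m) : dot u' v' <= enorm u' * enorm v'.
  by rewrite ler_norml h andbT lerNl -dotNl -(enormN u).
have [->|v0] := eqVneq v' 0; first by rewrite dot0r mulr_ge0.
have v1 : 0 < enorm v' by rewrite lt_neqAle enorm_ge0 eq_sym enorm_eq0 v0.
have := dot_ge0 (enorm v' *: u' - enorm u' *: v').
rewrite !(dotBl, dotBr, dotZl, dotZr) -!enorm_sqr (dotC v') => h.
have [u0|u0] := eqVneq (enorm u') 0.
  by move/eqP: u0; rewrite enorm_eq0 => /eqP ->; rewrite dot0l mulr_ge0.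
have u1 : 0 < enorm u' by rewrite lt_neqAle enorm_ge0 eq_sym u0.
rewrite -(ler_pM2l (mulr_gt0 u1 v1)); lra.
Qed.

Lemma ler_enormD m (u v : 'cV[R]_m) : enorm (u + v) <= enorm u + enorm v.
Proof.
rewrite -(@ler_pXn2r _ 2) ?nnegrE ?addr_ge0// enormD_sqr.
by have := dot_le_enorm u v; rewrite ler_norml => /andP[_]; lra.
Qed.

Lemma ler_enormB m (u v : 'cV[R]_m) : enorm (u - v) <= enorm u + enorm v.
Proof. by rewrite -(enormN v) ler_enormD. Qed.

Lemma ler_enorm_entry m (u v : 'cV[R]_m) :
  (forall i, `|u i 0| <= `|v i 0|) -> enorm u <= enorm v.
Proof.
move=> uv; rewrite ler_sqrt ?dot_ge0// !dotE; apply: ler_sum => i _.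
rewrite -!expr2 -(real_normK (num_real (u i 0))) -(real_normK (num_real (v i 0))).
by rewrite lerXn2r ?nnegrE.
Qed.

Lemma ler_entry_enorm m (u : 'cV[R]_m) i : `|u i 0| <= enorm u.
Proof.
rewrite -(@ler_pXn2r _ 2) ?nnegrE// real_normK ?num_real// enorm_sqr dotE.
by rewrite (bigD1 i)//= -expr2 lerDl sumr_ge0// => j _; rewrite -expr2 sqr_ge0.
Qed.

Lemma ler_enorm_sum m (u : 'cV[R]_m) : enorm u <= \sum_i `|u i 0|.
Proof.
rewrite -(@ler_pXn2r _ 2) ?nnegrE ?sumr_ge0// enorm_sqr dotE expr2 mulr_suml.
apply: ler_sum => i _; rewrite -expr2 -real_normK ?num_real// expr2.
by rewrite ler_wpM2l// (bigD1 i)//= lerDl sumr_ge0.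
Qed.

Lemma spectral_norm_has_sup m p (M : 'M[R]_(m, p)) :
  has_sup [set enorm (M *m v) | v in [set v : 'cV[R]_p | enorm v <= 1]].
Proof.
split; first by exists (enorm (M *m 0)), 0 => //=; rewrite enorm0.
exists (\sum_i enorm (row i M)^T) => _ [v /= v1 <-].
apply: (le_trans (ler_enorm_sum _)); apply: ler_sum => i _.
have -> : (M *m v) i 0 = dot (row i M)^T v.
  by rewrite dotE mxE; apply: eq_bigr => j _; rewrite !mxE.
by apply: (le_trans (dot_le_enorm _ _)); rewrite -[leRHS]mulr1 ler_wpM2l.
Qed.

Lemma spectral_norm_ge0 m p (M : 'M[R]_(m, p)) : 0 <= spectral_norm M.
Proof.
apply: le_trans (enorm_ge0 (M *m 0)) _.
apply: ub_le_sup; first by have [] := spectral_norm_has_sup M.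
by exists 0 => //=; rewrite enorm0.
Qed.

Lemma ler_enorm_mulmx m p (M : 'M[R]_(m, p)) v :
  enorm (M *m v) <= spectral_norm M * enorm v.
Proof.
have [->|v0] := eqVneq v 0; first by rewrite mulmx0 !enorm0 mulr0.
have v1 : 0 < enorm v by rewrite lt_neqAle enorm_ge0 eq_sym enorm_eq0 v0.
rewrite -ler_pdivrMr// mulrC -(ger0_norm (ltW v1)) -normfV -enormZ scalemxAr.
apply: ub_le_sup; first by have [] := spectral_norm_has_sup M.
exists ((enorm v)^-1 *: v) => //=.
by rewrite enormZ normfV ger0_norm// mulVf ?gt_eqF.
Qed.

Lemma ler_dot_mulmx m p (M : 'M[R]_(m, p)) u v :
  `|dot u (M *m v)| <= spectral_norm M * (enorm u * enorm v).
Proof.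
apply: (le_trans (dot_le_enorm _ _)).
by rewrite mulrCA ler_wpM2l// ler_enorm_mulmx.
Qed.

End EuclideanTheory.
#[local] Hint Extern 0 (is_true (0 <= enorm _)) => exact: enorm_ge0 : core.

(** * First-order inequalities for strongly convex and smooth functions *)

Section Regularity.
Context {R : realType}.

Lemma diff_gradient m (g : 'cV[R]_m -> R) x u : differentiable g x ->
  'd g x u = dot (gradient g x) u :> R.
Proof.
move=> dg; rewrite [in LHS](matrix_sum_delta u) linear_sum dotE.
apply: eq_bigr => i _; rewrite big_ord1 linearZ /= mxE mulrC.
by rewrite /GRing.scale.
Qed.

(** [dg] is any map satisfying the gradient inequality; together with a Lipschitz bound on [dg],
    this is the form in which convexity enters the later estimates. *)
Definition strongly_convex_grad m mu (g : 'cV[R]_m -> R)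
    (dg : 'cV[R]_m -> 'cV[R]_m) :=
  forall x y, g x + dot (dg x) (y - x) + mu / 2 * enorm (y - x) ^+ 2 <= g y.

(** The defining inequality at [h *: y + (1 - h) *: x], divided by [h], bounds a difference quotient
    of [g] at [x]; letting [h] decrease to 0 gives the gradient. *)
Lemma strongly_convex_gradient m mu (g : 'cV[R]_m -> R) :
  (forall x, differentiable g x) -> strongly_convex mu g ->
  strongly_convex_grad mu g (gradient g).
Proof.
move=> dg cg x y; set U := y - x; pose N := enorm U ^+ 2.
suff : dot (gradient g x) U <= g y - g x - mu / 2 * N by rewrite /N; lra.
have quotient_cvg :
    h^-1 * (g (h *: U + x) - g x) @[h --> 0^'+] --> dot (gradient g x) U.
  apply: cvg_dnbhs_at_right; rewrite -diff_gradient// -deriveE//.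
  exact: (diff_derivable (v := U) (dg x)).
have bound_cvg : g y - g x - mu / 2 * (1 - h) * N @[h --> 0^'+] -->
    g y - g x - mu / 2 * (1 - 0) * N.
  apply: cvg_at_right_filter.
  apply: cvgB; first exact: cvg_cst.
  apply: cvgM; last exact: cvg_cst.
  apply: cvgM; first exact: cvg_cst.
  by apply: cvgB; [exact: cvg_cst|exact: cvg_id].
rewrite -[mu / 2]mulr1 -[X in _ * X * N](subr0 1).
apply: (ler_cvg_to quotient_cvg bound_cvg).
near=> h.
have h0 : 0 < h by near: h; exact: nbhs_right_gt.
have h1 : h < 1 by near: h; exact: nbhs_right_lt.
have /cg : 0 <= h <= 1 by rewrite !ltW.
move=> /(_ y x).
have -> : h *: y + (1 - h) *: x = h *: U + x.
  by rewrite scalerBl scale1r scalerBr addrA addrAC.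
rewrite -/U -/N ler_pdivrMl// => hcg.
by rewrite -subr_ge0; move: hcg; rewrite -subr_ge0; lra.
Unshelve. all: by end_near.
Qed.

Variables (m : nat) (mu L : R) (g : 'cV[R]_m -> R) (dg : 'cV[R]_m -> 'cV[R]_m).
Hypothesis mu_gt0 : 0 < mu.
Hypothesis g_cvx : strongly_convex_grad mu g dg.

(** Young's inequality absorbs the linear term at 0 into half of the quadratic one. *)
Lemma strongly_convex_coercive y :
  g 0 - enorm (dg 0) ^+ 2 / mu + mu / 4 * enorm y ^+ 2 <= g y.
Proof.
have := g_cvx 0 y; rewrite subr0.
have := dot_le_enorm (dg 0) y; rewrite ler_norml => /andP[+ _].
have : 0 <= mu * (enorm y / 2 - enorm (dg 0) / mu) ^+ 2.
  by rewrite mulr_ge0 ?sqr_ge0// ltW.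
have -> : mu * (enorm y / 2 - enorm (dg 0) / mu) ^+ 2 =
    mu / 4 * enorm y ^+ 2 - enorm (dg 0) * enorm y + enorm (dg 0) ^+ 2 / mu.
  by field; rewrite gt_eqF.
by lra.
Qed.

Hypothesis g_smooth : forall x y, enorm (dg x - dg y) <= L * enorm (x - y).

(* Convexity gives the descent inequality with the constant L instead of L / 2,
   without integrating the gradient. *)
Lemma smooth_upper x y :
  g y <= g x + dot (dg x) (y - x) + L * enorm (y - x) ^+ 2.
Proof.
have := g_cvx y x.
have : `|dot (dg y - dg x) (y - x)| <= L * enorm (y - x) ^+ 2.
  apply: (le_trans (dot_le_enorm _ _)).
  by rewrite expr2 mulrA ler_wpM2r.
rewrite ler_norml => /andP[_]; rewrite dotBl.
have : 0 <= mu / 2 * enorm (x - y) ^+ 2.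
  by rewrite mulr_ge0 ?sqr_ge0// divr_ge0// ltW.
rewrite -(opprB y x) dotNr; lra.
Qed.

(** The gradient inequalities between 0 and a unit vector add up to [mu <= L]; a unit vector exists
    because the dimension is positive. *)
Lemma strong_convexity_le_smoothness : (0 < m)%N -> mu <= L.
Proof.
move=> m0; pose u : 'cV[R]_m := delta_mx (Ordinal m0) 0.
have u0 : 0 < enorm u ^+ 2.
  rewrite exprn_gt0// lt_neqAle enorm_ge0 eq_sym enorm_eq0 andbT.
  apply/eqP => /matrixP/(_ (Ordinal m0) 0)/eqP.
  by rewrite !mxE !eqxx oner_eq0.
rewrite -(ler_pM2r u0).
have := g_cvx 0 u; have := g_cvx u 0; rewrite subr0 sub0r dotNr enormN.
have : `|dot (dg u - dg 0) u| <= L * enorm u ^+ 2.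
  apply: (le_trans (dot_le_enorm _ _)).
  by rewrite expr2 mulrA ler_wpM2r// (le_trans (g_smooth _ _))// subr0.
by rewrite ler_norml => /andP[_]; rewrite dotBl; lra.
Qed.

End Regularity.

(** * Continuity of vector-valued maps, tested on entries *)

Section EntrywiseContinuity.
Context {R : realType} {T : topologicalType}.

Definition entrywise_continuous m (g : T -> 'cV[R]_m) (p : T) :=
  forall i, {for p, continuous (fun q => g q i 0)}.

Lemma continuous_sum (I : Type) (r : seq I) (g : I -> T -> R) (p : T) :
  (forall i, {for p, continuous (g i)}) ->
  {for p, continuous (fun q => \sum_(i <- r) g i q)}.
Proof.
move=> gp; apply: (cvg_big (op := +%R) (@add_continuous R)).
by move=> i _; exact: gp.
Qed.

Lemma continuous_dot m (g h : T -> 'cV[R]_m) p :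
  entrywise_continuous g p -> entrywise_continuous h p ->
  {for p, continuous (fun q => dot (g q) (h q))}.
Proof.
move=> gp hp; rewrite (_ : (fun q => _) = fun q => \sum_i g q i 0 * h q i 0).
  by apply: continuous_sum => i; exact: continuousM.
by apply/funext => q; rewrite dotE.
Qed.

Lemma continuous_enorm_sqr m (g : T -> 'cV[R]_m) p :
  entrywise_continuous g p -> {for p, continuous (fun q => enorm (g q) ^+ 2)}.
Proof.
move=> gp; rewrite (_ : (fun q => _) = fun q => dot (g q) (g q)).
  exact: continuous_dot.
by apply/funext => q; rewrite enorm_sqr.
Qed.

Lemma entrywise_continuousD m (g h : T -> 'cV[R]_m) p :
  entrywise_continuous g p -> entrywise_continuous h p ->
  entrywise_continuous (fun q => g q + h q) p.
Proof.
move=> gp hp i; rewrite (_ : (fun q => _) = fun q => g q i 0 + h q i 0).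
  exact: continuousD.
by apply/funext => q; rewrite mxE.
Qed.

Lemma entrywise_continuous_mulmx m k (M : 'M[R]_(k, m)) (g : T -> 'cV[R]_m) p :
  entrywise_continuous g p -> entrywise_continuous (fun q => M *m g q) p.
Proof.
move=> gp i; rewrite (_ : (fun q => _) = fun q => \sum_j M i j * g q j 0).
  by apply: continuous_sum => j; apply: continuousM => //; exact: cst_continuous.
by apply/funext => q; rewrite mxE.
Qed.

Lemma continuous_entrywise m (g : T -> 'cV[R]_m) p :
  {for p, continuous g} -> entrywise_continuous g p.
Proof.
move=> gp i.
apply: (@continuous_comp _ _ _ g (fun u : 'cV[R]_m => u i 0)) => //.
exact: coord_continuous.
Qed.

End EntrywiseContinuity.

(** * Smallest eigenvalue of [Q Q^T] and smallest positive eigenvalue of [Q^T Q] *)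

Section RayleighQuotient.
Context {R : realType}.
Variables (m p : nat) (Q : 'M[R]_(m, p)).
Hypotheses (m_gt0 : (0 < m)%N) (Q_full : \rank Q = m).

Lemma trmx_full_rank_eq0 (v : 'cV[R]_m) : Q^T *m v = 0 -> v = 0.
Proof.
move=> /(congr1 trmx); rewrite trmx_mul trmxK trmx0 => /eqP.
rewrite mulmx_free_eq0 ?/row_free ?Q_full// => /eqP /(congr1 trmx).
by rewrite trmxK trmx0.
Qed.

(** [Q Q^T] is injective, because [Q Q^T v = 0] forces [|Q^T v|^2 = 0]. *)
Lemma gram_surjective (r : 'cV[R]_m) : exists s, Q *m (Q^T *m s) = r.
Proof.
have QQ_unit : Q *m Q^T \in unitmx.
  rewrite -row_free_unit; apply: inj_row_free => v /(congr1 trmx).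
  rewrite !trmx_mul !trmxK trmx0 -mulmxA => vQQ.
  rewrite -[v]trmxK [v^T]trmx_full_rank_eq0 ?trmx0//.
  apply/eqP; rewrite -enorm_eq0 -sqrf_eq0 enorm_sqr dot_mulmxr trmxK.
  by rewrite vQQ dot0l.
by exists (invmx (Q *m Q^T) *m r); rewrite !mulmxA mulmxV// mul1mx.
Qed.

(* The minimum of the Rayleigh quotient of Q Q^T is an eigenvalue of Q Q^T,
   and Q^T maps its eigenvectors to eigenvectors of Q^T Q. *)
Lemma rayleigh_min : exists (a : R) (v : 'cV[R]_m),
  [/\ 0 < a, v != 0, Q *m (Q^T *m v) = a *: v
    & forall u, a * enorm u ^+ 2 <= enorm (Q^T *m u) ^+ 2].
Proof.
pose S := [set u : 'rV[R]_m | enorm u^T ^+ 2 = 1].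
have tr_cont (u : 'rV[R]_m) : entrywise_continuous (fun u : 'rV[R]_m => u^T) u.
  move=> i; rewrite (_ : (fun _ => _) = fun u : 'rV[R]_m => u 0 i).
    exact: coord_continuous.
  by apply/funext => w; rewrite mxE.
have S0 : S !=set0.
  exists (delta_mx 0 (Ordinal m_gt0)); rewrite /S /= enorm_sqr dotE.
  rewrite (bigD1 (Ordinal m_gt0))//= big1 => [|i /negPf i0].
    by rewrite !mxE !eqxx mulr1 addr0.
  by rewrite !mxE i0 mulr0.
have Sc : compact S.
  apply: bounded_closed_compact; last first.
    rewrite (_ : S = (fun u : 'rV[R]_m => enorm u^T ^+ 2) @^-1` [set 1])//.
    apply: closed_comp => [u _|]; last exact: closed_eq.
    exact: (continuous_enorm_sqr (tr_cont u)).
  exists 1; split => // b b1 u uS; apply: le_trans (ltW b1).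
  rewrite [`|u|]mx_normrE; apply: bigmax_le => // -[i j] _ /=.
  have -> : u i j = u^T j 0 by rewrite mxE (ord1 i).
  apply: (le_trans (ler_entry_enorm _ _)).
  by rewrite -(@ler_pXn2r _ 2) ?nnegrE// uS expr1n.
pose q (u : 'rV[R]_m) := enorm (Q^T *m u^T) ^+ 2.
have [|c cS cmin] := @EVT_min_rV R m q S S0 Sc.
  apply: continuous_subspaceT => u.
  exact: (continuous_enorm_sqr (entrywise_continuous_mulmx (M := Q^T) (tr_cont u))).
move: cS; rewrite inE => cS.
pose v := c^T; pose a := enorm (Q^T *m v) ^+ 2.
have v1 : enorm v ^+ 2 = 1 by [].
have v0 : v != 0.
  by rewrite -enorm_eq0 -sqrf_eq0 v1 oner_eq0.
have amin u : a * enorm u ^+ 2 <= enorm (Q^T *m u) ^+ 2.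
  have [->|u0] := eqVneq u 0; first by rewrite mulmx0 !enorm0 expr0n mulr0.
  have u1 : 0 < enorm u by rewrite lt_neqAle enorm_ge0 eq_sym enorm_eq0 u0.
  have := cmin ((enorm u)^-1 *: u)^T; rewrite inE /q /S /= trmxK.
  rewrite -scalemxAr !enormZ !exprMn normfV ger0_norm// exprVn mulVf; last first.
    by rewrite expf_neq0// gt_eqF.
  by move=> /(_ erefl); rewrite ler_pdivlMl ?exprn_gt0// mulrC.
exists a, v; split => //.
  rewrite exprn_gt0// lt_neqAle enorm_ge0 eq_sym enorm_eq0 andbT.
  by apply: contra v0 => /eqP/trmx_full_rank_eq0 ->.
apply/eqP; rewrite -subr_eq0 -enorm_eq0.
have [h hE] : exists h, h = Q *m (Q^T *m v) - a *: v by eexists.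
rewrite -hE.
pose b := enorm (Q^T *m h) ^+ 2 - a * enorm h ^+ 2.
(* Minimality on the line through [v] in the direction [h]; the linear coefficient is [2 |h|^2]
   precisely because [h] is the defect in the eigenvalue equation. *)
have quad t : 0 <= 2 * t * enorm h ^+ 2 + t ^+ 2 * b.
  have := amin (v + t *: h).
  rewrite mulmxDr -scalemxAr !enormD_sqr !enormZ !exprMn real_normK ?num_real//.
  rewrite -/a v1 !dotZr dot_mulmxr trmxK /b.
  have -> : dot (Q *m (Q^T *m v)) h = enorm h ^+ 2 + a * dot v h.
    by rewrite [in RHS]enorm_sqr {2}hE dotBl dotZl; lra.
  by lra.
have b0 : 0 <= b by rewrite subr_ge0.
have [//|h0] := eqVneq (enorm h) 0.
have h1 : 0 < enorm h ^+ 2 by rewrite exprn_gt0// lt_neqAle enorm_ge0 eq_sym h0.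
(* At this [t] the quadratic is negative unless [h = 0]; the 1 in the denominator covers [b = 0]. *)
have := quad (- enorm h ^+ 2 / (b + 1)).
have b1 : 0 < b + 1 by lra.
have -> : 2 * (- enorm h ^+ 2 / (b + 1)) * enorm h ^+ 2 +
    (- enorm h ^+ 2 / (b + 1)) ^+ 2 * b =
    - ((enorm h ^+ 2 / (b + 1)) ^+ 2 * (b + 2)).
  by field; rewrite gt_eqF.
rewrite oppr_ge0 leNgt mulr_gt0//; last by lra.
by rewrite exprn_gt0// divr_gt0.
Qed.

(** The minimum [a] of the Rayleigh quotient is a positive eigenvalue of [Q^T Q]. It is the least
    one: if [u] is an eigenvector for [b > 0], the Rayleigh bound at [Q u] reads
    [a b |u|^2 <= b^2 |u|^2]. *)
Lemma lambda_min_pos_gram : 0 < lambda_min_pos (Q^T *m Q) /\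
  forall u : 'cV[R]_m,
    lambda_min_pos (Q^T *m Q) * enorm u ^+ 2 <= enorm (Q^T *m u) ^+ 2.
Proof.
have [a [v [a0 v0 eig amin]]] := rayleigh_min.
set E := [set b | eigenvalue (Q^T *m Q) b /\ 0 < b].
have Ea : E a.
  split => //; apply/eigenvalueP; exists (Q^T *m v)^T.
    have QQ : Q^T *m Q *m (Q^T *m v) = a *: (Q^T *m v).
      by rewrite -mulmxA eig scalemxAr.
    move/(congr1 trmx): QQ.
    by rewrite [LHS]trmx_mul [(Q^T *m Q)^T]trmx_mul trmxK linearZ.
  apply: contra v0 => /eqP/(congr1 trmx); rewrite trmxK trmx0.
  by move/trmx_full_rank_eq0 => ->.
have lbE : lbound E a.
  move=> b [/eigenvalueP[u uQ u0] b0].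
  have := amin (Q *m u^T).
  have QQ : Q^T *m (Q *m u^T) = b *: u^T.
    by rewrite -linearZ /= -uQ !trmx_mul !trmxK mulmxA.
  rewrite QQ enormZ exprMn real_normK ?num_real//.
  rewrite [enorm (Q *m _) ^+ 2]enorm_sqr dot_mulmxr QQ dotZl -enorm_sqr.
  rewrite mulrA ler_pM2r ?expr2 ?ler_pM2r//.
  rewrite -expr2 exprn_gt0// lt_neqAle enorm_ge0 eq_sym enorm_eq0 andbT.
  by apply: contra u0 => /eqP/(congr1 trmx); rewrite trmxK trmx0 => ->.
have -> : lambda_min_pos (Q^T *m Q) = a.
  apply/eqP; rewrite eq_le lb_le_inf//; last by exists a.
  by rewrite andbT ge_inf//; exists a.
by [].
Qed.

End RayleighQuotient.

(** * Block decomposition of vectors and the intermediate points of a sweep *)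

Section BlockProjection.
Context {R : realType} {n : nat} {nb : 'I_n -> nat}.
Implicit Types u y : 'cV[R]_(\sum_i nb i).

Definition block_part (i : 'I_n) u : 'cV[R]_(\sum_i nb i) :=
  \mxcol_j (if j == i then submxcol u j else 0).

Lemma sum_block_part u : \sum_i block_part i u = u.
Proof.
apply/mxcolP => j; rewrite submxcol_sum (bigD1 j)//= mxcolK eqxx.
by rewrite big1 ?addr0// => i /negPf ij; rewrite mxcolK eq_sym ij.
Qed.

Lemma block_partE i u s :
  block_part i u s 0 = u s 0 \/ block_part i u s 0 = 0.
Proof.
rewrite !mxE; case: ifP => _; [left|right]; rewrite !mxE//.
by rewrite tagnat.sig2K.
Qed.

Lemma enorm_block_part_sqr i u :
  enorm (block_part i u) ^+ 2 = dot u (block_part i u).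
Proof.
rewrite enorm_sqr !dotE; apply: eq_bigr => s _.
by have [->|->] := block_partE i u s; rewrite ?mulr0.
Qed.

Lemma sum_enorm_block_part_sqr u :
  \sum_i enorm (block_part i u) ^+ 2 = enorm u ^+ 2.
Proof.
rewrite (eq_bigr (fun i => dot u (block_part i u))) => [|i _]; last first.
  exact: enorm_block_part_sqr.
by rewrite -dot_sumr sum_block_part enorm_sqr.
Qed.

Lemma block_partZ i a u : block_part i (a *: u) = a *: block_part i u.
Proof.
apply/matrixP => s t; rewrite (ord1 t) !mxE.
by case: ifP => _; rewrite !mxE ?mulr0.
Qed.

Lemma ler_enorm_block_part i u : enorm (block_part i u) <= enorm u.
Proof.
apply: ler_enorm_entry => s.
by have [->|->] := block_partE i u s; rewrite ?normr0.
Qed.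

(** Replacing a block is a translation inside that block, which turns block minimization into
    minimization along such directions. *)
Lemma set_blockE y i u :
  set_block y (submxcol u i) = y + block_part i (u - y).
Proof.
apply/mxcolP => j; rewrite mxcolK submxcolD mxcolK submxcolB.
case: dfwithP => [|k ik]; first by rewrite eqxx addrC subrK.
by rewrite eq_sym (negPf ik) addr0.
Qed.

(* The point reached within a sweep from [y] to [y'] after [k] block updates. *)
Definition sweep (y' y : 'cV[R]_(\sum_i nb i)) (k : nat) :
    'cV[R]_(\sum_i nb i) :=
  \mxcol_j (if (j < k)%N then submxcol y' j else submxcol y j).

Lemma sweep0 y' y : sweep y' y 0 = y.
Proof. by apply/mxcolP => j; rewrite mxcolK. Qed.

Lemma sweepn y' y : sweep y' y n = y'.
Proof. by apply/mxcolP => j; rewrite mxcolK ltn_ord. Qed.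

Lemma sweepS y' y (i : 'I_n) :
  sweep y' y i.+1 = set_block (mix_blocks y' y i) (submxcol y' i).
Proof.
apply/mxcolP => j; rewrite !mxcolK; case: dfwithP => [|k ik].
  by rewrite ltnSn.
by rewrite mxcolK ltnS leq_eqVlt eq_sym (negPf ik : (i : nat) == k = false).
Qed.

Lemma set_block_mix_blocks y' y u (i : 'I_n) :
  set_block (mix_blocks y' y i) (submxcol u i) =
  sweep y' y i.+1 + block_part i (u - sweep y' y i.+1).
Proof.
apply/mxcolP => j.
rewrite submxcolD [submxcol (block_part _ _) _]mxcolK submxcolB [LHS]mxcolK.
case: dfwithP => [|k ik]; first by rewrite eqxx addrC subrK.
rewrite eq_sym (negPf ik) addr0 !mxcolK.
by rewrite [in RHS]ltnS [in RHS]leq_eqVlt [X in X || _]eq_sym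
  (negPf ik : (i : nat) == k = false).
Qed.

Lemma sweep_pred y' y (i : 'I_n) :
  sweep y' y i = sweep y' y i.+1 + block_part i (y - y').
Proof.
apply/mxcolP => j; rewrite submxcolD !mxcolK submxcolB.
rewrite [in RHS]ltnS [in RHS]leq_eqVlt; have [->|ji] := eqVneq j i.
  by rewrite ltnn eqxx /= addrC subrK.
by rewrite (negPf ji : (j : nat) == i = false) /= addr0.
Qed.

Lemma submxcol_sweepS y' y (i : 'I_n) :
  submxcol (sweep y' y i.+1) i = submxcol y' i.
Proof. by rewrite mxcolK ltnSn. Qed.

Lemma sweep_entry y' y k s :
  sweep y' y k s 0 = y' s 0 \/ sweep y' y k s 0 = y s 0.
Proof.
by rewrite !mxE; case: ifP => _; [left|right]; rewrite !mxE tagnat.sig2K.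
Qed.

Lemma ler_enorm_sweepB y' y k : enorm (sweep y' y k - y') <= enorm (y' - y).
Proof.
apply: ler_enorm_entry => s; rewrite mxE [X in _ <= `|X|]mxE.
have [|] := sweep_entry y' y k s => E; rewrite E !mxE.
  by rewrite subrr normr0.
by rewrite distrC.
Qed.

End BlockProjection.

(** * Exact expansion and norm estimates of the quadratic operator *)

Section QuadraticOperator.
Context {R : realType} {n : nat} {nb : 'I_n -> nat} {nc : nat}.
Variables (C : 'I_nc -> 'M[R]_(\sum_i nb i)).
Variables (d : 'I_nc -> 'cV[R]_(\sum_i nb i)) (e : 'I_nc -> R).
Implicit Types x u y : 'cV[R]_(\sum_i nb i).
Local Notation A := (quadratic_op C d e).

(** The derivative of [A] at [x] in the direction [u]; it has two halves because the [C j] may fail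
    to be symmetric. *)
Definition quadratic_op_diff x u : 'cV[R]_nc :=
  \col_j (2^-1 * dot u (C j *m x) + 2^-1 * dot x (C j *m u) + dot (d j) u).
Local Notation dA := quadratic_op_diff.

Definition quadratic_op_sq u : 'cV[R]_nc := \col_j (2^-1 * dot u (C j *m u)).
Local Notation qA := quadratic_op_sq.

Lemma quadratic_opD x u : A (x + u) = A x + dA x u + qA u.
Proof.
apply/colP => j; rewrite !mxE mulmxDr !dotDl !dotDr; lra.
Qed.

Lemma quadratic_op_diffD x u v : dA x (u + v) = dA x u + dA x v.
Proof.
apply/colP => j; rewrite !mxE mulmxDr !dotDl !dotDr; lra.
Qed.

Lemma quadratic_op_diffZ x a u : dA x (a *: u) = a *: dA x u.
Proof.
apply/colP => j; rewrite !mxE -scalemxAr !dotZr !dotZl; lra.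
Qed.

Lemma quadratic_op_diff_sum x (u : 'I_n -> 'cV[R]_(\sum_i nb i)) :
  dA x (\sum_i u i) = \sum_i dA x (u i).
Proof.
apply: (big_morph _ (quadratic_op_diffD x)).
by rewrite -(scale0r (0 : 'cV_(\sum_i nb i))) quadratic_op_diffZ scale0r.
Qed.

Lemma quadratic_op_sqN u : qA (- u) = qA u.
Proof. by apply/colP => j; rewrite !mxE mulmxN dotNl dotNr opprK. Qed.

(** Along one block [A] is affine, so for [v] in that block the second difference
    [A v + A (- v) - 2 A 0], which is twice [qA v], vanishes. *)
Lemma quadratic_op_sq_block i u : multiaffine A -> qA (block_part i u) = 0.
Proof.
move=> /(_ i 0)[M [b Mb]].
have AE a : A (a *: block_part i u) = a *: (M *m submxcol u i) + b.
  have -> : a *: (M *m submxcol u i) = M *m submxcol (a *: u) i.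
    by rewrite scalemxAr; congr (_ *m _); apply/matrixP => r s; rewrite !mxE.
  rewrite -Mb set_blockE add0r subr0; congr A.
  apply/mxcolP => j; rewrite mxcolK.
  have -> : submxcol (a *: block_part i u) j = a *: submxcol (block_part i u) j.
    by apply/matrixP => r s; rewrite !mxE.
  rewrite mxcolK; case: ifP => _; last by rewrite scaler0.
  by apply/matrixP => r s; rewrite !mxE.
have := AE 1; have := AE (-1); have := AE 0.
rewrite scale0r scale0r add0r scaleN1r !scale1r => A0.
rewrite -[block_part i u]add0r -[X in A (- X)]add0r opprD oppr0.
rewrite !quadratic_opD A0 !add0r -(scaleN1r (block_part i u)) quadratic_op_diffZ.
rewrite scaleN1r scaleN1r quadratic_op_sqN => /matrixP h1 /matrixP h2.
apply/matrixP => r s; move: (h1 r s) (h2 r s); rewrite !mxE; lra.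
Qed.

(** Sums over the components of [A], since [ler_enorm_sum] bounds a Euclidean norm by the sum of the
    absolute entries. *)
Let S := \sum_j spectral_norm (C j).
Let D := \sum_j enorm (d j).
Let E := \sum_j `|e j|.

Let S_ge0 : 0 <= S. Proof. by apply: sumr_ge0 => j _; exact: spectral_norm_ge0. Qed.
Let D_ge0 : 0 <= D. Proof. by apply: sumr_ge0. Qed.

Lemma ler_quadratic_op_diffB x y u :
  enorm (dA x u - dA y u) <= S * (enorm (x - y) * enorm u).
Proof.
apply: (le_trans (ler_enorm_sum _)); rewrite mulr_suml; apply: ler_sum => j _.
have -> : (dA x u - dA y u) j 0 =
    2^-1 * dot u (C j *m (x - y)) + 2^-1 * dot (x - y) (C j *m u).
  by rewrite !mxE mulmxBr !(dotBl, dotBr); lra.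
have := ler_dot_mulmx (C j) u (x - y); have := ler_dot_mulmx (C j) (x - y) u.
rewrite (mulrC (enorm u)) !ler_norml => /andP[? ?] /andP[? ?].
by apply/andP; split; lra.
Qed.

Lemma ler_quadratic_op_diff x u : enorm (dA x u) <= (S * enorm x + D) * enorm u.
Proof.
have -> : dA x u = (dA x u - dA 0 u) + dA 0 u by rewrite subrK.
apply: (le_trans (ler_enormD _ _)); rewrite mulrDl lerD//.
  by rewrite -mulrA (le_trans (ler_quadratic_op_diffB _ _ _))// subr0.
apply: (le_trans (ler_enorm_sum _)); rewrite mulr_suml; apply: ler_sum => j _.
rewrite mxE mulmx0 dot0r dot0l !mulr0 !add0r; exact: dot_le_enorm.
Qed.

Lemma ler_quadratic_op_sq u : enorm (qA u) <= S / 2 * enorm u ^+ 2.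
Proof.
apply: (le_trans (ler_enorm_sum _)); rewrite !mulr_suml; apply: ler_sum => j _.
rewrite mxE normrM ger0_norm ?invr_ge0// expr2.
by have := ler_dot_mulmx (C j) u u; lra.
Qed.

Lemma ler_quadratic_opB x y b : enorm x <= b -> enorm y <= b ->
  enorm (A x - A y) <= (S * b *+ 2 + D) * enorm (x - y).
Proof.
move=> xb yb; have b0 := le_trans (enorm_ge0 _) xb.
have := quadratic_opD y (x - y); rewrite [y + _]addrC subrK => ->.
rewrite -[X in X - _]addrA addrAC subrr add0r.
apply: (le_trans (ler_enormD _ _)).
have h1 := ler_quadratic_op_diff y (x - y).
have h2 := ler_quadratic_op_sq (x - y).
have h3 : enorm (x - y) <= b + b.
  by apply: (le_trans (ler_enormB _ _)); rewrite lerD.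
have h4 : S / 2 * enorm (x - y) ^+ 2 <= S * b * enorm (x - y).
  by rewrite expr2 mulrA ler_wpM2r// -mulrA ler_wpM2l//; lra.
have h5 : (S * enorm y + D) * enorm (x - y) <= (S * b + D) * enorm (x - y).
  by rewrite ler_wpM2r// lerD2r ler_wpM2l.
rewrite mulr2n; lra.
Qed.

Lemma ler_quadratic_op x : enorm (A x) <= S * enorm x ^+ 2 + D * enorm x + E.
Proof.
have -> : A x = A 0 + dA 0 x + qA x by rewrite -quadratic_opD add0r.
apply: (le_trans (ler_enormD _ _)).
apply: (le_trans (lerD (ler_enormD _ _) (lexx _))).
have h1 := ler_quadratic_op_diff 0 x.
have h2 := ler_quadratic_op_sq x.
have h3 : enorm (A 0) <= E.
  apply: (le_trans (ler_enorm_sum _)); apply: ler_sum => j _.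
  by rewrite mxE mulmx0 !dot0r mulr0 !add0r.
have h4 : 0 <= S * enorm x ^+ 2 by rewrite mulr_ge0// sqr_ge0.
move: h1; rewrite enorm0 mulr0 add0r; lra.
Qed.

End QuadraticOperator.

(** * The real-valued augmented Lagrangian: lower bounds, [z]-step and dual step *)

Section AugmentedLagrangian.
Context {R : realType} {m nz nc : nat}.
Variables (f : 'cV[R]_m -> R) (df : 'cV[R]_m -> 'cV[R]_m) (mu_f : R).
Variables (phi : 'cV[R]_nz -> R) (dphi : 'cV[R]_nz -> 'cV[R]_nz).
Variables (mu_phi L_phi : R) (Q : 'M[R]_(nc, nz)) (rho : R).
Hypothesis nc_gt0 : (0 < nc)%N.
Hypothesis mu_f_gt0 : 0 < mu_f.
Hypothesis f_cvx : strongly_convex_grad mu_f f df.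
Hypothesis mu_phi_gt0 : 0 < mu_phi.
Hypothesis phi_cvx : strongly_convex_grad mu_phi phi dphi.
Hypothesis phi_smooth : forall x y,
  enorm (dphi x - dphi y) <= L_phi * enorm (x - y).
Hypothesis Q_full : \rank Q = nc.
Hypothesis rho_gt0 : 0 < rho.

(** Only the part [f] of the objective enters; the value is that of [auglag] at points whose blocks
    are all feasible ([auglag_in]). *)
Definition lagr (A : 'cV[R]_m -> 'cV[R]_nc) x z w : R :=
  f x + phi z + dot w (A x + Q *m z) + rho / 2 * enorm (A x + Q *m z) ^+ 2.

Let lam := lambda_min_pos (Q^T *m Q).
Hypothesis rho_ge : 4 * L_phi ^+ 2 / (mu_phi * lam) <= rho.

Let lam_gt0 : 0 < lam.
Proof. by have [] := lambda_min_pos_gram nc_gt0 Q_full. Qed.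

Let lam_min (u : 'cV[R]_nc) : lam * enorm u ^+ 2 <= enorm (Q^T *m u) ^+ 2.
Proof. by have [_] := lambda_min_pos_gram nc_gt0 Q_full; apply. Qed.

Let mu_le_L : mu_phi <= L_phi.
Proof.
apply: (strong_convexity_le_smoothness phi_cvx phi_smooth).
by rewrite (leq_trans nc_gt0)// -Q_full rank_leq_col.
Qed.

Let L_gt0 : 0 < L_phi. Proof. exact: lt_le_trans mu_phi_gt0 mu_le_L. Qed.

Let rho_mu : L_phi ^+ 2 / lam <= rho * (mu_phi / 4).
Proof.
have := rho_ge; rewrite ler_pdivrMr ?mulr_gt0//.
by rewrite ler_pdivrMr//; lra.
Qed.

Let rho_L : L_phi / lam <= rho / 4.
Proof.
rewrite -(ler_pM2l L_gt0) mulrA -expr2; apply: (le_trans rho_mu).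
have : rho * mu_phi <= rho * L_phi by rewrite ler_wpM2l// ltW.
lra.
Qed.

(* A dual variable with Q^T w = - grad phi(z) turns the linear term of the
   Lagrangian into the first-order correction of phi between z and the nearby
   point z' that satisfies the constraint exactly. *)
Lemma lagr_lower A x z w : Q^T *m w = - dphi z -> exists z',
  [/\ A x + Q *m z' = 0,
      lam * enorm (z - z') ^+ 2 <= enorm (A x + Q *m z) ^+ 2
    & f x + phi z' + rho / 4 * enorm (A x + Q *m z) ^+ 2 <= lagr A x z w].
Proof.
move=> wz; set r := A x + Q *m z.
(* [z - Q^T s] is the orthogonal projection of [z] onto the solutions [z'] of [A x + Q z' = 0]. *)
have [s sr] := gram_surjective Q_full r.
have ssr : enorm (Q^T *m s) ^+ 2 = dot s r by rewrite enorm_sqr -dot_mulmxr sr.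
have sr_le : dot s r <= enorm s * enorm r.
  exact: le_trans (ler_norm _) (dot_le_enorm _ _).
have s_le : lam * enorm s <= enorm r.
  have [->|s0] := eqVneq (enorm s) 0; first by rewrite mulr0.
  have s1 : 0 < enorm s by rewrite lt_neqAle enorm_ge0 eq_sym s0.
  rewrite -(ler_pM2r s1); have := lam_min s; rewrite ssr; lra.
have Qs_le : lam * enorm (Q^T *m s) ^+ 2 <= enorm r ^+ 2.
  rewrite ssr; apply: (@le_trans _ _ (lam * (enorm s * enorm r))).
    by rewrite ler_pM2l.
  by rewrite mulrA expr2 ler_wpM2r.
exists (z - Q^T *m s); split.
- by rewrite mulmxBr sr addrA -/r subrr.
- by rewrite opprB addrC subrK.
have := smooth_upper mu_phi_gt0 phi_cvx phi_smooth z (z - Q^T *m s).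
rewrite [z - _ - z]addrAC subrr add0r dotNr enormN.
have -> : - dot (dphi z) (Q^T *m s) = dot w r.
  by rewrite -dotNl -wz -dot_mulmxr sr.
(* The quadratic error of the expansion of [phi] uses up half of the penalty; the other half stays
   in the conclusion. *)
have h : L_phi * enorm (Q^T *m s) ^+ 2 <= rho / 4 * enorm r ^+ 2.
  apply: (@le_trans _ _ (L_phi / lam * enorm r ^+ 2)).
    by rewrite -mulrA ler_pM2l// ler_pdivlMl.
  by rewrite ler_wpM2r// sqr_ge0.
by rewrite /lagr -/r; lra.
Qed.

(** Lower bounds of [f] and [phi], in general below their minima. *)
Let f_min := f 0 - enorm (df 0) ^+ 2 / mu_f.
Let phi_min := phi 0 - enorm (dphi 0) ^+ 2 / mu_phi.

Let f_ge x : f_min + mu_f / 4 * enorm x ^+ 2 <= f x.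
Proof. exact: strongly_convex_coercive. Qed.

Let phi_ge z : phi_min + mu_phi / 4 * enorm z ^+ 2 <= phi z.
Proof. exact: strongly_convex_coercive. Qed.

Lemma lagr_lower_bound A x z w : Q^T *m w = - dphi z ->
  f_min + phi_min <= lagr A x z w.
Proof.
move=> /(lagr_lower A x)[z' [_ _]]; apply: le_trans.
have := f_ge x; have := phi_ge z'.
have : 0 <= mu_f / 4 * enorm x ^+ 2 by rewrite !mulr_ge0 ?sqr_ge0// ltW.
have : 0 <= mu_phi / 4 * enorm z' ^+ 2 by rewrite !mulr_ge0 ?sqr_ge0// ltW.
have : 0 <= rho / 4 * enorm (A x + Q *m z) ^+ 2.
  by rewrite !mulr_ge0 ?sqr_ge0// ltW.
lra.
Qed.

(** [B] is chosen before [A], so it does not depend on the operator. Coercivity of [f] bounds [x],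
    that of [phi] bounds [z'], the penalty bounds [z - z'], and the equation for [Q^T w] then bounds
    [w]. *)
Lemma lagr_bounded_sublevel K : exists B, forall A x z w,
  Q^T *m w = - dphi z -> lagr A x z w <= K ->
  [/\ enorm x <= B, enorm z <= B & enorm w <= B].
Proof.
pose K' := `|K - f_min - phi_min|.
pose bound (c : R) := Num.sqrt (c^-1 * K').
have boundP m' (c : R) (u : 'cV[R]_m') : 0 < c -> c * enorm u ^+ 2 <= K' ->
    enorm u <= bound c.
  move=> c0 cu; rewrite -(@ler_pXn2r _ 2) ?nnegrE ?sqrtr_ge0//.
  by rewrite [leRHS]sqr_sqrtr ?mulr_ge0 ?normr_ge0 ?invr_ge0 ?(ltW c0)//
    ler_pdivlMl.
pose Bx := bound (mu_f / 4).
pose Bz := bound (mu_phi / 4) + bound (rho / 4 * lam).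
pose Bw := (enorm (dphi 0) + L_phi * Bz) / Num.sqrt lam.
exists (Num.max Bx (Num.max Bz Bw)) => A x z w wz.
have [z' [_ zz' +]] := lagr_lower A x wz => lb ub.
have fx := f_ge x; have phz := phi_ge z'.
have K'_ge : K - f_min - phi_min <= K' by exact: ler_norm.
have x2 : 0 <= mu_f / 4 * enorm x ^+ 2 by rewrite !mulr_ge0 ?sqr_ge0// ltW.
have z2 : 0 <= mu_phi / 4 * enorm z' ^+ 2 by rewrite !mulr_ge0 ?sqr_ge0// ltW.
have r2 : 0 <= rho / 4 * enorm (A x + Q *m z) ^+ 2.
  by rewrite !mulr_ge0 ?sqr_ge0// ltW.
have x_le : enorm x <= Bx by apply: boundP; [rewrite divr_gt0|lra].
have z_le : enorm z <= Bz.
  have -> : z = z' + (z - z') by rewrite addrC subrK.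
  apply: (le_trans (ler_enormD _ _)); rewrite lerD//.
    by apply: boundP; [rewrite divr_gt0|lra].
  apply: boundP; first by rewrite mulr_gt0// divr_gt0.
  rewrite -mulrA; apply: (@le_trans _ _ (rho / 4 * enorm (A x + Q *m z) ^+ 2)).
    by rewrite ler_pM2l// divr_gt0.
  lra.
rewrite !le_max x_le z_le !orbT; split => //.
suff -> : enorm w <= Bw by rewrite !orbT.
rewrite ler_pdivlMr ?sqrtr_gt0//.
apply: (@le_trans _ _ (enorm (dphi z))).
  rewrite -(@ler_pXn2r _ 2) ?nnegrE ?mulr_ge0 ?sqrtr_ge0//.
  rewrite exprMn [Num.sqrt lam ^+ 2]sqr_sqrtr ?(ltW lam_gt0)// mulrC.
  rewrite -(enormN (dphi z)) -wz.
  exact: lam_min.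
have -> : dphi z = dphi 0 + (dphi z - dphi 0) by rewrite addrC subrK.
apply: (le_trans (ler_enormD _ _)); rewrite lerD2l.
apply: (le_trans (phi_smooth _ _)); rewrite subr0 ler_pM2l//.
Qed.

Lemma lagr_step_w A x z w :
  lagr A x z (w + rho *: (A x + Q *m z)) =
  lagr A x z w + rho * enorm (A x + Q *m z) ^+ 2.
Proof. by rewrite /lagr dotDl dotZl -enorm_sqr; lra. Qed.

(** This serves the first dual step, where [w] is arbitrary: by Young's inequality the Lagrangian
    itself bounds [rho |r|^2]. *)
Lemma lagr_step_w_le A x z w K : lagr A x z w <= K ->
  lagr A x z (w + rho *: (A x + Q *m z)) <=
  K + 4 * (K - f_min - phi_min + enorm w ^+ 2 / rho).
Proof.
rewrite lagr_step_w /lagr; set r := A x + Q *m z => ub.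
have := f_ge x; have := phi_ge z.
have : 0 <= mu_f / 4 * enorm x ^+ 2 by rewrite !mulr_ge0 ?sqr_ge0// ltW.
have : 0 <= mu_phi / 4 * enorm z ^+ 2 by rewrite !mulr_ge0 ?sqr_ge0// ltW.
have := dot_le_enorm w r; rewrite ler_norml => /andP[+ _].
have : 0 <= rho * (enorm r / 2 - enorm w / rho) ^+ 2.
  by rewrite mulr_ge0 ?sqr_ge0// ltW.
have -> : rho * (enorm r / 2 - enorm w / rho) ^+ 2 =
    rho / 4 * enorm r ^+ 2 - enorm w * enorm r + enorm w ^+ 2 / rho.
  by field; rewrite gt_eqF.
lra.
Qed.

Lemma first_order_ge0 (a b : R) :
  (forall t, 0 < t <= 1 -> 0 <= t * a + t ^+ 2 * b) -> 0 <= a.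
Proof.
move=> h; rewrite leNgt; apply/negP => a0.
have b1 : 0 < `|b| - a + 1 by have := normr_ge0 b; lra.
(* Small enough for the linear term to win: [a + t |b| = t (a - 1) < 0]. *)
pose t := - a / (`|b| - a + 1).
have t0 : 0 < t by rewrite divr_gt0// oppr_gt0.
have t1 : t <= 1 by rewrite ler_pdivrMr// mul1r; have := normr_ge0 b; lra.
have := h t; rewrite t0 t1 => /(_ isT).
rewrite expr2 -mulrA -mulrDr pmulr_rge0//.
have : t * b <= t * `|b| by rewrite ler_pM2l// ler_norm.
have -> : t * `|b| = - a + t * (a - 1).
  by rewrite /t; field; rewrite gt_eqF.
have : t * (a - 1) < 0 by rewrite pmulr_rlt0//; lra.
lra.
Qed.

(** With [G] the gradient of the Lagrangian in [z], comparing [z] with [z - t G] gives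
    [0 <= - t |G|^2 + O(t^2)], so [G = 0]. *)
Lemma lagr_argmin_z A x z w : (forall u, lagr A x z w <= lagr A x u w) ->
  Q^T *m (w + rho *: (A x + Q *m z)) = - dphi z.
Proof.
move=> zmin; apply/eqP; rewrite -subr_eq0 opprK -enorm_eq0.
set r := A x + Q *m z; set G := _ + _.
rewrite -sqrf_eq0 eq_le sqr_ge0 andbT -oppr_ge0.
apply: (@first_order_ge0 _ (L_phi * enorm G ^+ 2 + rho / 2 * enorm (Q *m G) ^+ 2)).
move=> t _; have := zmin (z - t *: G).
have := smooth_upper mu_phi_gt0 phi_cvx phi_smooth z (z - t *: G).
rewrite /lagr mulmxBr addrA -/r [z - _ - z]addrAC subrr add0r -scaleN1r scalerA.
rewrite -scalemxAr -[r - _]/(r + - _) -[- (t *: (Q *m G))]scaleN1r scalerA mulN1r.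
rewrite enormD_sqr !enormZ !exprMn real_normK ?num_real// sqrrN.
rewrite !dotDr !dotZr.
have -> : enorm G ^+ 2 = dot w (Q *m G) + rho * dot r (Q *m G) + dot (dphi z) G.
  by rewrite enorm_sqr {1}/G dotDl -dot_mulmxr dotDl dotZl.
lra.
Qed.

(** The optimality condition at [z'] cancels the linear terms; strong convexity of [phi] and a
    nonnegative penalty term remain. *)
Lemma lagr_step_z A x z z' w :
  Q^T *m (w + rho *: (A x + Q *m z')) = - dphi z' ->
  lagr A x z' w + mu_phi / 2 * enorm (z - z') ^+ 2 <= lagr A x z w.
Proof.
set r := A x + Q *m z' => z'opt; set h := z - z'.
have := phi_cvx z' z; rewrite -/h.
have -> : dot (dphi z') h = - dot w (Q *m h) - rho * dot r (Q *m h).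
  rewrite -[dphi z']opprK -z'opt dotNl -dot_mulmxr.
  by rewrite dotDl dotZl opprD.
rewrite /lagr -/r.
have -> : A x + Q *m z = r + Q *m h.
  by rewrite /r /h mulmxBr addrACA subrr addr0.
rewrite (enormD_sqr r) (dotDr _ r).
have : 0 <= rho / 2 * enorm (Q *m h) ^+ 2 by rewrite !mulr_ge0 ?sqr_ge0// ltW.
lra.
Qed.

(** [lam_min] turns the Lipschitz bound on [dphi] into one on the multipliers, and [rho] is large
    enough to replace [L_phi^2 / lam] by [rho mu_phi / 4]. *)
Lemma dual_step_le z z' w w' : Q^T *m w = - dphi z -> Q^T *m w' = - dphi z' ->
  enorm (w' - w) ^+ 2 <= rho * (mu_phi / 4) * enorm (z' - z) ^+ 2.
Proof.
move=> wz wz'; apply: (@le_trans _ _ (L_phi ^+ 2 / lam * enorm (z' - z) ^+ 2)).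
  rewrite mulrAC ler_pdivlMr// mulrC; apply: (le_trans (lam_min _)).
  have -> : Q^T *m (w' - w) = - (dphi z' - dphi z).
    by rewrite mulmxBr wz wz' opprB opprK addrC.
  by rewrite enormN -exprMn lerXn2r ?nnegrE ?mulr_ge0 ?(ltW L_gt0).
by rewrite ler_wpM2r// sqr_ge0.
Qed.

End AugmentedLagrangian.

(** * Passage from extended real to real values at points with feasible blocks *)

Section CompositeObjective.
Context {R : realType} {n : nat} {nb : 'I_n -> nat} {nz nc : nat}.
Variables (f : 'cV[R]_(\sum_i nb i) -> R) (X : forall i : 'I_n, set 'cV[R]_(nb i)).
Variables (phi : 'cV[R]_nz -> R) (Q : 'M[R]_(nc, nz)) (rho : R).
Variable A : 'cV[R]_(\sum_i nb i) -> 'cV[R]_nc.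
Implicit Types x y u : 'cV[R]_(\sum_i nb i).

Definition in_blocks x := forall i, @X i (submxcol x i).

Lemma composite_in x : in_blocks x -> composite f X x = (f x)%:E.
Proof.
move=> xX; rewrite /composite big1 ?adde0// => i _.
by rewrite /indicator ifT// inE.
Qed.

Lemma composite_lty x : (composite f X x < +oo)%E -> in_blocks x.
Proof.
move=> xlt i; apply: contrapT => xi; move: xlt; rewrite /composite.
suff -> : (\sum_(j < n) indicator (@X j) (submxcol x j) = +oo :> \bar R)%E by [].
have ind_neq j : true -> indicator (@X j) (submxcol x j) != -oo%E :> \bar R.
  by rewrite /indicator; case: ifP.
apply/(esum_eqyP _ ind_neq); exists i; split => //; first exact: mem_index_enum.
by rewrite /indicator ifF//; apply/negbTE/negP; rewrite inE.
Qed.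

Lemma auglag_in x z w : in_blocks x ->
  auglag (composite f X) phi A Q rho x z w = (lagr f phi Q rho A x z w)%:E.
Proof.
by move=> xX; rewrite /auglag composite_in// -EFinD /lagr !addrA.
Qed.

Lemma auglag_lty x z w :
  (auglag (composite f X) phi A Q rho x z w < +oo)%E -> in_blocks x.
Proof.
rewrite /auglag => h; apply: composite_lty; move: h.
by case: (composite f X x) => // r _; exact: ltry.
Qed.

Lemma in_blocks_set_block y i u : in_blocks y -> @X i (submxcol u i) ->
  in_blocks (y + block_part i (u - y)).
Proof.
move=> yX uX j; rewrite -set_blockE mxcolK.
by case: dfwithP => [|k ik]; [exact: uX|exact: yX].
Qed.

End CompositeObjective.

(** * Feasibility and minimality of the iterates and of the points within a sweep *)

Section Iterates.
Context {R : realType} {n : nat} {nb : 'I_n -> nat} {nz nc : nat}.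
Variables (f : 'cV[R]_(\sum_i nb i) -> R) (X : forall i : 'I_n, set 'cV[R]_(nb i)).
Variables (phi : 'cV[R]_nz -> R) (Q : 'M[R]_(nc, nz)) (rho : R).
Variable A : 'cV[R]_(\sum_i nb i) -> 'cV[R]_nc.
Variables (x0 : 'cV[R]_(\sum_i nb i)) (z0 : 'cV[R]_nz) (w0 : 'cV[R]_nc).
Variables (x : nat -> 'cV[R]_(\sum_i nb i)) (z : nat -> 'cV[R]_nz).
Variable w : nat -> 'cV[R]_nc.
Hypothesis iter : admm_iterates (composite f X) phi A Q rho x0 z0 w0 x z w.
Local Notation lagrA := (lagr f phi Q rho A).

(** [argmin] demands a finite value, so already the first block update forces the blocks not yet
    updated to be feasible. *)
Lemma sweep_in_blocks k (i : 'I_n) : in_blocks X (sweep (x k.+1) (x k) i.+1).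
Proof.
have [_ _ _ /(_ k)[/(_ i)[+ _] _ _]] := iter.
by rewrite /= -sweepS => /auglag_lty.
Qed.

Lemma iterate_in_blocks k : in_blocks X (x k.+1).
Proof.
by move=> i; rewrite -(submxcol_sweepS (x k.+1) (x k)); exact: sweep_in_blocks.
Qed.

Lemma sweep_argmin k (i : 'I_n) u : @X i (submxcol u i) ->
  lagrA (sweep (x k.+1) (x k) i.+1) (z k) (w k) <=
  lagrA (sweep (x k.+1) (x k) i.+1 +
        block_part i (u - sweep (x k.+1) (x k) i.+1)) (z k) (w k).
Proof.
move=> uX; have [_ _ _ /(_ k)[/(_ i)[_ h] _ _]] := iter; have := h (submxcol u i).
rewrite /= -sweepS set_block_mix_blocks !auglag_in ?lee_fin//.
  by apply: in_blocks_set_block => //; exact: sweep_in_blocks.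
exact: sweep_in_blocks.
Qed.

Lemma iterate_argmin_z k u :
  lagrA (x k.+1) (z k.+1) (w k) <= lagrA (x k.+1) u (w k).
Proof.
have [_ _ _ /(_ k)[_ [_ h] _]] := iter; have := h u.
by rewrite !auglag_in ?lee_fin//; exact: iterate_in_blocks.
Qed.

Lemma iterate_dual k : w k.+1 = w k + rho *: (A (x k.+1) + Q *m z k.+1).
Proof. by have [_ _ _ /(_ k)[]] := iter. Qed.

Lemma sweep_decreasing k (i : 'I_n) : in_blocks X (sweep (x k.+1) (x k) i) ->
  lagrA (sweep (x k.+1) (x k) i.+1) (z k) (w k) <=
  lagrA (sweep (x k.+1) (x k) i) (z k) (w k).
Proof.
move=> /(_ i) yX; have := sweep_argmin k yX.
set y := sweep _ _ i.
suff E : set_block (sweep (x k.+1) (x k) i.+1) (submxcol y i) = y.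
  by rewrite -set_blockE E.
apply/mxcolP => j; rewrite mxcolK; case: dfwithP => // j' ij; rewrite !mxcolK.
by rewrite [in LHS]ltnS [in LHS]leq_eqVlt [X in X || _]eq_sym
  (negPf ij : (i : nat) == j' = false).
Qed.

(* If the blocks of x0 other than the first are infeasible, no first iterate
   exists, so only the first block of the comparison point may differ from x0. *)
Lemma first_sweep_le p :
  (forall i, @X i (submxcol p i) /\
     (@X i (submxcol x0 i) -> submxcol p i = submxcol x0 i)) ->
  lagrA (x 1%N) z0 w0 <= lagrA p z0 w0.
Proof.
move=> pP; have [x0E z0E w0E _] := iter.
have [n0|n_gt0] := posnP n.
  suff -> : x 1%N = p by [].
  by apply/mxcolP => -[i i_lt]; exfalso; move: i_lt; rewrite n0.
pose i0 := Ordinal n_gt0.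
have start : lagrA (sweep (x 1%N) (x 0%N) 1) z0 w0 <= lagrA p z0 w0.
  have := sweep_argmin 0 (i := i0) (proj1 (pP i0)); rewrite z0E w0E -set_blockE.
  suff -> : set_block (sweep (x 1%N) (x 0%N) i0.+1) (submxcol p i0) = p by [].
  apply/mxcolP => j; rewrite mxcolK; case: dfwithP => // j' ij.
  have j0 : (j' < 1)%N = false by case: j' ij => -[].
  have [_] := pP j'; rewrite -x0E mxcolK j0 => -> //.
  by have := sweep_in_blocks 0 i0 j'; rewrite mxcolK j0.
have := sweepn (x 1%N) (x 0%N) => <-.
suff h k : (0 < k <= n)%N -> lagrA (sweep (x 1%N) (x 0%N) k) z0 w0 <= lagrA p z0 w0.
  by apply: h; rewrite n_gt0 leqnn.
elim: k => // -[//|k] IH /andP[_ kn].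
apply: le_trans (IH _); last by rewrite /= ltnW.
have := @sweep_decreasing 0 (Ordinal kn); rewrite z0E w0E; apply.
exact: (sweep_in_blocks 0 (Ordinal (ltnW kn : (k < n)%N))).
Qed.

End Iterates.

(** * Descent along the iterates and the contraction inequality *)

Section Convergence.
Context {R : realType} {n : nat} {nb : 'I_n -> nat} {nz nc : nat}.
Variables (f : 'cV[R]_(\sum_i nb i) -> R).
Variables (df : 'cV[R]_(\sum_i nb i) -> 'cV[R]_(\sum_i nb i)) (mu_f L_f : R).
Variables (X : forall i : 'I_n, set 'cV[R]_(nb i)).
Variables (phi : 'cV[R]_nz -> R) (dphi : 'cV[R]_nz -> 'cV[R]_nz).
Variables (mu_phi L_phi : R) (Q : 'M[R]_(nc, nz)) (rho : R).
Hypothesis nc_gt0 : (0 < nc)%N.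
Hypothesis mu_f_gt0 : 0 < mu_f.
Hypothesis f_cvx : strongly_convex_grad mu_f f df.
Hypothesis f_smooth : forall x y,
  enorm (df x - df y) <= L_f * enorm (x - y).
Hypothesis X_cvx : forall i, convex_set (@X i).
Hypothesis mu_phi_gt0 : 0 < mu_phi.
Hypothesis phi_cvx : strongly_convex_grad mu_phi phi dphi.
Hypothesis phi_smooth : forall x y,
  enorm (dphi x - dphi y) <= L_phi * enorm (x - y).
Hypothesis Q_full : \rank Q = nc.
Hypothesis rho_gt0 : 0 < rho.
Hypothesis rho_ge : 4 * L_phi ^+ 2 / (mu_phi * lambda_min_pos (Q^T *m Q)) <= rho.
Variables (d : 'I_nc -> 'cV[R]_(\sum_i nb i)) (e : 'I_nc -> R).
Variables (x0 : 'cV[R]_(\sum_i nb i)) (z0 : 'cV[R]_nz) (w0 : 'cV[R]_nc).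
Variable C : 'I_nc -> 'M[R]_(\sum_i nb i).
Local Notation A := (quadratic_op C d e).
Local Notation dA := (quadratic_op_diff C d).
Local Notation lagrA := (lagr f phi Q rho A).
Hypothesis A_affine : multiaffine A.
Variables (x : nat -> 'cV[R]_(\sum_i nb i)) (z : nat -> 'cV[R]_nz).
Variable w : nat -> 'cV[R]_nc.
Hypothesis iter : admm_iterates (composite f X) phi A Q rho x0 z0 w0 x z w.

Local Notation swept k i := (sweep (x k.+1) (x k) i.+1).

(** As [A] is affine along a block, the Lagrangian minus [f] is exactly quadratic in [t]. *)
Lemma lagr_block_line y z' w' i u t :
  lagrA (y + t *: block_part i u) z' w' =
  lagrA y z' w' + (f (y + t *: block_part i u) - f y)
  + t * dot (w' + rho *: (A y + Q *m z')) (dA y (block_part i u))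
  + t ^+ 2 * (rho / 2 * enorm (dA y (block_part i u)) ^+ 2).
Proof.
have -> : t *: block_part i u = block_part i (t *: u) by rewrite block_partZ.
rewrite /lagr quadratic_opD (quadratic_op_sq_block _ _ A_affine) addr0 block_partZ.
rewrite quadratic_op_diffZ [A y + _ + _]addrAC.
set r := A y + _; set v := dA _ _.
rewrite enormD_sqr dotDr dotDl !dotZr dotZl enormZ exprMn real_normK ?num_real//.
lra.
Qed.

Lemma convex_combination i (a b : 'cV[R]_(nb i)) (t : R) : 0 < t <= 1 ->
  @X i a -> @X i b -> @X i (t *: a + (1 - t) *: b).
Proof.
move=> /andP[t0 t1] aX bX.
have := X_cvx (Itv01 (ltW t0) t1) (mem_set aX) (mem_set bX).
by rewrite inE.
Qed.

(** Variational inequality of the block minimization: by convexity the segment towards [u] stays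
    feasible, and its linear term must be nonnegative. *)
Lemma block_first_order k i u : @X i (submxcol u i) ->
  0 <= dot (df (swept k i)) (block_part i (u - swept k i))
    + dot (w k + rho *: (A (swept k i) + Q *m z k))
        (dA (swept k i) (block_part i (u - swept k i))).
Proof.
move=> uX; set y := swept k i; set v := block_part _ _.
apply: (@first_order_ge0 _ _ (L_f * enorm v ^+ 2 + rho / 2 * enorm (dA y v) ^+ 2)).
move=> t t01.
have utX : @X i (submxcol (y + t *: (u - y)) i).
  have -> : submxcol (y + t *: (u - y)) i =
      t *: submxcol u i + (1 - t) *: submxcol y i.
    by apply/matrixP => r s; rewrite !mxE; lra.
  by apply: convex_combination => //; exact: (sweep_in_blocks iter k i i).
have := sweep_argmin iter k utX; rewrite -/y.
rewrite [y + _ - y]addrAC subrr add0r block_partZ -/v lagr_block_line -/v.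
have := smooth_upper mu_f_gt0 f_cvx f_smooth y (y + t *: v).
rewrite [y + _ - y]addrAC subrr add0r dotZr enormZ exprMn real_normK ?num_real//.
lra.
Qed.

Lemma block_descent k i u : @X i (submxcol u i) ->
  lagrA (swept k i) (z k) (w k)
    + mu_f / 2 * enorm (block_part i (u - swept k i)) ^+ 2 <=
  lagrA (swept k i + block_part i (u - swept k i)) (z k) (w k).
Proof.
move=> uX; set y := swept k i; set v := block_part _ _.
have := block_first_order k uX; rewrite -/y -/v => fo.
have := f_cvx y (y + v); rewrite [y + _ - y]addrAC subrr add0r => fv.
rewrite -[v in leRHS]scale1r lagr_block_line -/v !scale1r.
have : 0 <= rho / 2 * enorm (dA y v) ^+ 2 by rewrite !mulr_ge0 ?sqr_ge0// ltW.
lra.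
Qed.

(** The block updates telescope, and their squared lengths add up to that of the whole step because
    the blocks are orthogonal. *)
Lemma sweep_descent k : in_blocks X (x k) ->
  lagrA (x k.+1) (z k) (w k) + mu_f / 2 * enorm (x k - x k.+1) ^+ 2 <=
  lagrA (x k) (z k) (w k).
Proof.
move=> xX; pose g i := lagrA (sweep (x k.+1) (x k) i) (z k) (w k).
suff : mu_f / 2 * enorm (x k - x k.+1) ^+ 2 <= g 0%N - g n.
  by rewrite /g sweep0 sweepn; lra.
rewrite -[g 0%N - g n]opprB -(telescope_sumr g (leq0n n)) big_mkord.
rewrite -sumrN -sum_enorm_block_part_sqr mulr_sumr; apply: ler_sum => i _.
have := block_descent k (xX i).
suff <- : sweep (x k.+1) (x k) i =
    sweep (x k.+1) (x k) i.+1 + block_part i (x k - sweep (x k.+1) (x k) i.+1).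
  suff <- : block_part i (x k - x k.+1) =
      block_part i (x k - sweep (x k.+1) (x k) i.+1) by rewrite /g; lra.
  apply/mxcolP => j; rewrite !mxcolK; case: eqP => // ->.
  by rewrite !submxcolB submxcol_sweepS.
rewrite [LHS]sweep_pred; congr (_ + _).
apply/mxcolP => j; rewrite !mxcolK; case: eqP => // ->.
by rewrite !submxcolB submxcol_sweepS.
Qed.

(** The dual update makes the optimality condition of the [z]-step an equation for the new
    multiplier. *)
Lemma iterate_dual_gradient k : Q^T *m w k.+1 = - dphi (z k.+1).
Proof.
rewrite (iterate_dual iter).
apply: (lagr_argmin_z mu_phi_gt0 phi_cvx phi_smooth (f := f)) => u.
exact: (iterate_argmin_z iter k u).
Qed.

(** The residual is the dual step divided by [rho]. The gradient equation is available from index 1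
    on and is used at two consecutive indices, hence [k.+2]. *)
Lemma residual_le k :
  rho * enorm (A (x k.+2) + Q *m z k.+2) ^+ 2 <=
  mu_phi / 4 * enorm (z k.+2 - z k.+1) ^+ 2.
Proof.
have := dual_step_le nc_gt0 mu_phi_gt0 phi_cvx phi_smooth Q_full rho_ge
  (iterate_dual_gradient k) (iterate_dual_gradient k.+1).
rewrite (iterate_dual iter) addrC addKr enormZ exprMn real_normK ?num_real//.
by rewrite expr2 -!mulrA ler_pM2l// mulrA.
Qed.

Definition iterate_lagr k := lagrA (x k) (z k) (w k).

(** The dual step raises the Lagrangian by [rho |r|^2], which [residual_le] bounds by half of the
    gain [mu_phi / 2 |z - z'|^2] of the [z]-step. *)
Lemma iterate_lagr_descent k :
  iterate_lagr k.+2 + mu_f / 2 * enorm (x k.+2 - x k.+1) ^+ 2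
    + mu_phi / 4 * enorm (z k.+2 - z k.+1) ^+ 2 <= iterate_lagr k.+1.
Proof.
have := sweep_descent (iterate_in_blocks iter k).
have := @lagr_step_z _ _ _ _ f phi dphi mu_phi Q rho phi_cvx rho_gt0
  A (x k.+2) (z k.+1) (z k.+2) (w k.+1).
rewrite -(iterate_dual iter) => /(_ (iterate_dual_gradient k.+1)).
have := residual_le k.
have := lagr_step_w f phi Q rho A (x k.+2) (z k.+2) (w k.+1).
rewrite -(iterate_dual iter) /iterate_lagr => ->.
rewrite (enormB (x k.+2)) (enormB (z k.+2)); lra.
Qed.

Lemma iterate_lagr_le k : iterate_lagr k.+1 <= iterate_lagr 1.
Proof.
elim: k => // k; apply: le_trans; have := iterate_lagr_descent k.
have : 0 <= mu_f / 2 * enorm (x k.+2 - x k.+1) ^+ 2.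
  by rewrite !mulr_ge0 ?sqr_ge0// ltW.
have : 0 <= mu_phi / 4 * enorm (z k.+2 - z k.+1) ^+ 2.
  by rewrite !mulr_ge0 ?sqr_ge0// ltW.
lra.
Qed.

Let S := \sum_j spectral_norm (C j).
Let D := \sum_j enorm (d j).
Let S_ge0 : 0 <= S. Proof. by apply: sumr_ge0 => j _; exact: spectral_norm_ge0. Qed.
Let D_ge0 : 0 <= D. Proof. by apply: sumr_ge0. Qed.

Variable B : R.
Hypothesis x_le : forall k, enorm (x k.+1) <= B.
Hypothesis w_le : forall k, enorm (w k.+1) <= B.

Let B_ge0 : 0 <= B. Proof. exact: le_trans (enorm_ge0 _) (x_le 0). Qed.

Let step k := enorm (x k.+2 - x k.+1) + enorm (z k.+2 - z k.+1).
(** One term each for the change of [df], of the multiplier and of [dA]; [B *+ 3] bounds the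
    intermediate points of a sweep, which lie within [2 B] of the new iterate. *)
Let G := `|L_f|
  + rho * (S * (B *+ 3) *+ 2 + D + spectral_norm Q) * (S * (B *+ 3) + D)
  + B * S.

Let G_ge0 : 0 <= G.
Proof.
have B3 : 0 <= B *+ 3 by rewrite mulrn_wge0.
have SB : 0 <= S * (B *+ 3) by rewrite mulr_ge0.
rewrite !addr_ge0 ?mulr_ge0 ?addr_ge0 ?mulrn_wge0 ?spectral_norm_ge0//.
exact: ltW.
Qed.

(* The block optimality conditions hold at intermediate points of the sweep and
   with the old z and w; this bounds the error made by evaluating them at the
   new iterate. *)
Lemma gradient_mismatch k (i : 'I_n) v :
  dot (df (swept k.+1 i)) v
    + dot (w k.+1 + rho *: (A (swept k.+1 i) + Q *m z k.+1))
        (dA (swept k.+1 i) v) <=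
  dot (df (x k.+2)) v + dot (w k.+2) (dA (x k.+2) v) + G * step k * enorm v.
Proof.
set y := swept k.+1 i; set s := w k.+1 + _; set x' := x k.+2; set w' := w k.+2.
have yx : enorm (y - x') <= step k.
  by apply: (le_trans (ler_enorm_sweepB _ _ _)); rewrite lerDl.
have y_le : enorm y <= B *+ 3.
  have -> : y = x' + (y - x') by rewrite addrC subrK.
  apply: (le_trans (ler_enormD _ _)).
  apply: (le_trans (lerD (x_le _) (ler_enorm_sweepB _ _ _))).
  have := ler_enormB (x k.+2) (x k.+1); have := x_le k; have := x_le k.+1.
  rewrite !mulrS mulr0n; lra.
have x'_le : enorm x' <= B *+ 3.
  by apply: (le_trans (x_le _)); have := B_ge0; rewrite !mulrS mulr0n; lra.
have B3 : 0 <= B *+ 3 by exact: le_trans y_le.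
have step_ge0 : 0 <= step k by rewrite addr_ge0.
have h1 : dot (df y - df x') v <= `|L_f| * step k * enorm v.
  apply: (le_trans (ler_norm _)); apply: (le_trans (dot_le_enorm _ _)).
  rewrite ler_wpM2r//; apply: (le_trans (f_smooth _ _)).
  apply: (@le_trans _ _ (`|L_f| * enorm (y - x'))); last by rewrite ler_wpM2l.
  by rewrite ler_wpM2r// ler_norm.
have sw : enorm (s - w') <=
    rho * (S * (B *+ 3) *+ 2 + D + spectral_norm Q) * step k.
  have -> : s - w' = rho *: ((A y - A x') - Q *m (z k.+2 - z k.+1)).
    rewrite /s /w' (iterate_dual iter k.+1) -/x' opprD addrACA subrr add0r.
    by rewrite -scalerBr opprD addrACA mulmxBr opprB.
  rewrite enormZ ger0_norm ?(ltW rho_gt0)// -mulrA ler_pM2l//.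
  apply: (le_trans (ler_enormB _ _)); rewrite mulrDl lerD//.
    apply: (le_trans (ler_quadratic_opB C d e y_le x'_le)).
    by rewrite ler_wpM2l// addr_ge0// mulrn_wge0// mulr_ge0.
  apply: (le_trans (ler_enorm_mulmx _ _)).
  by rewrite ler_wpM2l ?spectral_norm_ge0// lerDr.
have h2 : dot (s - w') (dA y v) <=
    rho * (S * (B *+ 3) *+ 2 + D + spectral_norm Q) * (S * (B *+ 3) + D) * step k
    * enorm v.
  apply: (le_trans (ler_norm _)); apply: (le_trans (dot_le_enorm _ _)).
  rewrite -[_ * _ * step k]mulrA [_ * step k]mulrC mulrA -[leRHS]mulrA.
  apply: ler_pM => //; apply: (le_trans (ler_quadratic_op_diff C d y v)).
  by rewrite ler_wpM2r// lerD2r ler_wpM2l.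
have h3 : dot w' (dA y v - dA x' v) <= B * S * step k * enorm v.
  apply: (le_trans (ler_norm _)); apply: (le_trans (dot_le_enorm _ _)).
  rewrite -!mulrA; apply: ler_pM => //; first exact: w_le.
  apply: (le_trans (ler_quadratic_op_diffB C d y x' v)).
  by rewrite ler_wpM2l// ler_wpM2r.
rewrite /G; move: h1 h2 h3; rewrite !(dotBl, dotBr); lra.
Qed.

Hypothesis curvature : B * S <= mu_f / 2.

(* The Lagrangian with multiplier w^{k+2} is convex in (x, z), strongly so in x;
   its value at a feasible point does not depend on the multiplier. *)
Lemma feasible_lower_bound k xb zb : in_blocks X xb -> A xb + Q *m zb = 0 ->
  iterate_lagr k.+2 - rho / 2 * enorm (A (x k.+2) + Q *m z k.+2) ^+ 2
    - (n%:R * G * step k) ^+ 2 / mu_f <= f xb + phi zb.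
Proof.
move=> xbX feas; set x' := x k.+2; set z' := z k.+2; set w' := w k.+2.
set v := xb - x'; set r := A x' + Q *m z'.
(* The block conditions are summed; every block contributes one mismatch, whence the factor [n]. *)
have stat : - (n%:R * G * step k) * enorm v <=
    dot (df x') v + dot w' (dA x' v).
  have -> : - (n%:R * G * step k) * enorm v =
      \sum_(i < n) - (G * step k * enorm v).
    by rewrite sumr_const card_ord -mulr_natl; lra.
  rewrite -{2 3}(sum_block_part v) quadratic_op_diff_sum !dot_sumr -big_split /=.
  apply: ler_sum => i _; rewrite lerNl -subr_ge0 opprK.
  have := block_first_order k.+1 (xbX i).
  have -> : block_part i (xb - sweep (x k.+2) (x k.+1) i.+1) = block_part i v.
    apply/mxcolP => j; rewrite !mxcolK; case: eqP => // ->.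
    by rewrite !submxcolB submxcol_sweepS.
  move=> fo; have := le_trans fo (gradient_mismatch k i (block_part i v)).
  have : G * step k * enorm (block_part i v) <= G * step k * enorm v.
    by rewrite ler_wpM2l ?ler_enorm_block_part// mulr_ge0// addr_ge0.
  rewrite -/x' -/w'; lra.
have fxb := f_cvx x' xb; rewrite -/v in fxb.
have phzb := phi_cvx z' zb.
have dphiE : dot (dphi z') (zb - z') = - dot w' (Q *m (zb - z')).
  by rewrite -[dphi z']opprK -iterate_dual_gradient dotNl -dot_mulmxr.
have feasE : dot w' r + dot w' (dA x' v) + dot w' (quadratic_op_sq C v)
    + dot w' (Q *m (zb - z')) = 0.
  rewrite -!dotDr; suff -> : r + dA x' v + quadratic_op_sq C v + Q *m (zb - z') =
      A xb + Q *m zb by rewrite feas dot0r.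
  have -> : A xb = A (x' + v) by rewrite /v addrC subrK.
  rewrite quadratic_opD mulmxBr /r; apply/matrixP => a b; rewrite !mxE; lra.
(* The curvature of the multiplier term costs at most half of the strong convexity of [f]; Young's
   inequality below spends the other half on the mismatch. *)
have curv : - (mu_f / 4 * enorm v ^+ 2) <= dot w' (quadratic_op_sq C v).
  rewrite lerNl -dotNr; apply: (le_trans (ler_norm _)).
  apply: (le_trans (dot_le_enorm _ _)); rewrite enormN.
  apply: (@le_trans _ _ (B * (S / 2 * enorm v ^+ 2))).
    by apply: ler_pM => //; [exact: w_le|exact: ler_quadratic_op_sq].
  rewrite 2!mulrA ler_wpM2r ?sqr_ge0//; have := curvature; lra.
have zz : 0 <= mu_phi / 2 * enorm (zb - z') ^+ 2.
  by rewrite !mulr_ge0 ?sqr_ge0// ltW.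
have : 0 <= mu_f * (enorm v / 2 - (n%:R * G * step k) / mu_f) ^+ 2.
  by rewrite mulr_ge0 ?sqr_ge0// ltW.
have -> : mu_f * (enorm v / 2 - (n%:R * G * step k) / mu_f) ^+ 2 =
    mu_f / 4 * enorm v ^+ 2 - (n%:R * G * step k) * enorm v
    + (n%:R * G * step k) ^+ 2 / mu_f.
  by field; rewrite gt_eqF.
rewrite /iterate_lagr -/x' -/z' -/w' /lagr -/r; lra.
Qed.

(** Both error terms of [feasible_lower_bound] are multiples of squared steps or residuals, hence
    bounded by the decrease of the Lagrangian. *)
Lemma iterate_gap : exists2 K, 0 < K & forall k xb zb,
  in_blocks X xb -> A xb + Q *m zb = 0 ->
  iterate_lagr k.+2 - K * (iterate_lagr k.+1 - iterate_lagr k.+2) <= f xb + phi zb.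
Proof.
pose c := Num.min (mu_f / 2) (mu_phi / 4).
have c0 : 0 < c by rewrite lt_min !divr_gt0.
have [H HE] : exists H, H = (n%:R * G) ^+ 2 / mu_f by eexists.
have H0 : 0 <= H by rewrite HE divr_ge0 ?sqr_ge0// ltW.
(* The 1 pays for the residual, the rest for the step, by [step^2 <= 2 (a^2 + b^2) <= 2 gap / c]. *)
exists (1 + H * 2 / c) => [|k xb zb xbX feas].
  have : 0 <= H * 2 / c by rewrite divr_ge0 ?(ltW c0)// mulr_ge0.
  lra.
apply: le_trans (feasible_lower_bound k xbX feas).
have desc := iterate_lagr_descent k; have res := residual_le k.
set a := enorm (x _ - _) in desc; set b := enorm (z _ - _) in desc res.
set gap := iterate_lagr k.+1 - _.
have stepE : step k ^+ 2 <= 2 * (a ^+ 2 + b ^+ 2).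
  rewrite /step -/a -/b; have := sqr_ge0 (a - b); rewrite sqrrB sqrrD; lra.
have cab : c * (a ^+ 2 + b ^+ 2) <= gap.
  have ca : c * a ^+ 2 <= mu_f / 2 * a ^+ 2.
    by rewrite ler_wpM2r ?sqr_ge0// ge_min lexx.
  have cb : c * b ^+ 2 <= mu_phi / 4 * b ^+ 2.
    by rewrite ler_wpM2r ?sqr_ge0// ge_min lexx orbT.
  by rewrite /gap; lra.
have ab_le : a ^+ 2 + b ^+ 2 <= gap / c by rewrite ler_pdivlMr// mulrC.
have Hs : (n%:R * G * step k) ^+ 2 / mu_f <= H * 2 / c * gap.
  rewrite exprMn mulrAC -HE -!mulrA ler_wpM2l//.
  by apply: (le_trans stepE); rewrite ler_pM2l// mulrC.
have a2 : 0 <= mu_f / 2 * a ^+ 2 by rewrite mulr_ge0 ?sqr_ge0// divr_ge0// ltW.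
have b2 : 0 <= mu_phi / 4 * b ^+ 2 by rewrite mulr_ge0 ?sqr_ge0// divr_ge0// ltW.
have r2 : 0 <= rho * enorm (A (x k.+2) + Q *m z k.+2) ^+ 2.
  by rewrite mulr_ge0 ?sqr_ge0// ltW.
have res_gap : rho * enorm (A (x k.+2) + Q *m z k.+2) ^+ 2 <= gap.
  by rewrite /gap; lra.
by move: Hs res_gap r2; rewrite mulrDl mul1r; clearbody gap; lra.
Qed.

Lemma residual_gap k : rho * enorm (A (x k.+2) + Q *m z k.+2) ^+ 2 <=
  iterate_lagr k.+1 - iterate_lagr k.+2.
Proof.
have := residual_le k; have := iterate_lagr_descent k.
have : 0 <= mu_f / 2 * enorm (x k.+2 - x k.+1) ^+ 2.
  by rewrite !mulr_ge0 ?sqr_ge0// ltW.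
lra.
Qed.

End Convergence.

(** * Continuous functions and closed sets at cluster points *)

Section Cluster.
Context {R : realType} {T : topologicalType}.
Variables (u : nat -> T) (p : T).
Hypothesis up : cluster (u @ \oo) p.

(** Every neighbourhood of [l] meets every neighbourhood of [g p], so the two agree in the Hausdorff
    space [R]. *)
Lemma cluster_continuous_lim (g : T -> R) (l : R) :
  {for p, continuous g} -> (g \o u) @ \oo --> l -> g p = l.
Proof.
move=> gp gul; apply/esym/(@Rhausdorff R) => P P' lP gpP'.
have [q [qP qP']] := @up (g @^-1` P) (g @^-1` P') (gul _ lP) (gp _ gpP').
by exists (g q).
Qed.

Lemma cluster_continuous_closed (U : topologicalType) (g : T -> U) (S : set U) :
  {for p, continuous g} -> closed S -> (\forall k \near \oo, S (g (u k))) ->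
  S (g p).
Proof.
move=> gp Sc Su; apply: Sc => P gpP.
by have [q [qS qP]] := @up (g @^-1` S) (g @^-1` P) Su (gp _ gpP); exists (g q).
Qed.

End Cluster.

Lemma continuous_submxcol {R : realType} {n : nat} {nb : 'I_n -> nat} (i : 'I_n) :
  continuous (fun x : 'cV[R]_(\sum_i nb i) => submxcol x i).
Proof.
move=> x P /nbhs_ballP[eps eps0 epsP]; apply/nbhs_ballP; exists eps => // y [_ xy].
by apply: epsP; split => // r s; rewrite !mxE; exact: xy.
Qed.

(** The hypothesis rearranges to [(1 + K) g_{k+1} <= K g_k]. *)
Lemma geometric_decay {R : realType} (g : nat -> R) (K : R) : 0 < K ->
  (forall k, g k.+1 <= K * (g k - g k.+1)) ->
  forall k, g k <= g 0%N * ((1 + K) / K) ^- k.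
Proof.
move=> K0 gK; elim=> [|k IH]; first by rewrite expr0 invr1 mulr1.
have K1 : 0 < (1 + K) / K by rewrite divr_gt0// addr_gt0.
rewrite exprS invfM mulrCA ler_pdivlMl//; apply: le_trans IH.
by have := gK k; rewrite mulrAC ler_pdivrMr//; lra.
Qed.

(** * Bounds uniform in [C], linear rate and minimality of the limit point *)

Section LinearConvergence.
Context {R : realType} {n : nat} {nb : 'I_n -> nat} {nz nc : nat}.
Variables (f : 'cV[R]_(\sum_i nb i) -> R).
Variables (df : 'cV[R]_(\sum_i nb i) -> 'cV[R]_(\sum_i nb i)) (mu_f L_f : R).
Variables (X : forall i : 'I_n, set 'cV[R]_(nb i)).
Variables (phi : 'cV[R]_nz -> R) (dphi : 'cV[R]_nz -> 'cV[R]_nz).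
Variables (mu_phi L_phi : R) (Q : 'M[R]_(nc, nz)) (rho : R).
Hypothesis nc_gt0 : (0 < nc)%N.
Hypothesis mu_f_gt0 : 0 < mu_f.
Hypothesis f_cont : continuous f.
Hypothesis f_cvx : strongly_convex_grad mu_f f df.
Hypothesis f_smooth : forall x y,
  enorm (df x - df y) <= L_f * enorm (x - y).
Hypothesis X_neq0 : forall i, @X i !=set0.
Hypothesis X_closed : forall i, closed (@X i).
Hypothesis X_cvx : forall i, convex_set (@X i).
Hypothesis mu_phi_gt0 : 0 < mu_phi.
Hypothesis phi_cont : continuous phi.
Hypothesis phi_cvx : strongly_convex_grad mu_phi phi dphi.
Hypothesis phi_smooth : forall x y,
  enorm (dphi x - dphi y) <= L_phi * enorm (x - y).
Hypothesis Q_full : \rank Q = nc.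
Hypothesis rho_gt0 : 0 < rho.
Hypothesis rho_ge : 4 * L_phi ^+ 2 / (mu_phi * lambda_min_pos (Q^T *m Q)) <= rho.
Variables (d : 'I_nc -> 'cV[R]_(\sum_i nb i)) (e : 'I_nc -> R).
Variables (x0 : 'cV[R]_(\sum_i nb i)) (z0 : 'cV[R]_nz) (w0 : 'cV[R]_nc).

(** [K] precedes [C], so the first sweep is compared with a point built from [x0] and [X] alone. *)
Lemma initial_lagr_bounded : exists K, forall C x z w,
  (forall j, spectral_norm (C j) <= 1) ->
  admm_iterates (composite f X) phi (quadratic_op C d e) Q rho x0 z0 w0 x z w ->
  lagr f phi Q rho (quadratic_op C d e) (x 1%N) (z 1%N) (w 1%N) <= K.
Proof.
(* [p] is [x0] with its infeasible blocks replaced by feasible ones. *)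
have [p pP] : exists p, forall i, @X i (submxcol p i) /\
    (@X i (submxcol x0 i) -> submxcol p i = submxcol x0 i).
  have h i : exists v, @X i v /\ (@X i (submxcol x0 i) -> v = submxcol x0 i).
    have [xX|xX] := pselect (@X i (submxcol x0 i)); first by exists (submxcol x0 i).
    by have [v vX] := X_neq0 i; exists v.
  exists (\mxcol_i projT1 (cid (h i))) => i; rewrite mxcolK.
  by case: (cid _).
(* [a] bounds the residual at [(p, z0)] for all [C j] of norm at most 1. *)
pose a := nc%:R * enorm p ^+ 2 + (\sum_j enorm (d j)) * enorm p + \sum_j `|e j|
  + enorm (Q *m z0).
pose K0 := f p + phi z0 + enorm w0 * a + rho / 2 * a ^+ 2.
exists (K0 + 4 * (K0 - (f 0 - enorm (df 0) ^+ 2 / mu_f)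
  - (phi 0 - enorm (dphi 0) ^+ 2 / mu_phi) + enorm w0 ^+ 2 / rho)).
move=> C x z w C1 iter.
have [_ z0E w0E _] := iter.
rewrite (iterate_dual iter) -w0E.
apply: (lagr_step_w_le mu_f_gt0 f_cvx mu_phi_gt0 phi_cvx rho_gt0).
apply: (le_trans (iterate_argmin_z iter 0 (z 0%N))).
rewrite z0E w0E; apply: (le_trans (first_sweep_le iter pP)).
have r_le : enorm (quadratic_op C d e p + Q *m z0) <= a.
  apply: (le_trans (ler_enormD _ _)); rewrite lerD2r.
  apply: (le_trans (ler_quadratic_op C d e p)); rewrite !lerD2r.
  rewrite ler_wpM2r ?sqr_ge0// -[X in _ <= X%:R]card_ord -sumr_const.
  exact: ler_sum.
rewrite /lagr /K0; set r := _ + Q *m z0 in r_le *.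
have h1 : dot w0 r <= enorm w0 * a.
  apply: (le_trans (ler_norm _)); apply: (le_trans (dot_le_enorm _ _)).
  by rewrite ler_wpM2l.
have h2 : rho / 2 * enorm r ^+ 2 <= rho / 2 * a ^+ 2.
  rewrite ler_pM2l ?divr_gt0// lerXn2r// nnegrE //.
  exact: le_trans r_le.
by rewrite !lerD.
Qed.

Local Notation iterate_space :=
  ('cV[R]_(\sum_i nb i) * 'cV[R]_nz * 'cV[R]_nc)%type.

Lemma admm_linear_convergence : exists2 eps : R, 0 < eps &
  forall C, let A := quadratic_op C d e in
  let L := auglag (composite f X) phi A Q rho in
  multiaffine A -> (forall j, spectral_norm (C j) <= eps) ->
  forall x z w xs zs ws,
  admm_iterates (composite f X) phi A Q rho x0 z0 w0 x z w ->
  cluster ((fun k => (x k, z k, w k)) @ \oo) (xs, zs, ws) ->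
  (exists c1 : R, 1 < c1 /\
     exists M : R, \forall k \near \oo,
       (`|L (x k) (z k) (w k) - L xs zs ws| <= (M * c1 ^- k)%:E)%E) /\
  local_minimum (composite f X) phi A Q xs zs.
Proof.
have [K0 K0P] := initial_lagr_bounded.
have [B BP] := lagr_bounded_sublevel nc_gt0 mu_f_gt0 f_cvx mu_phi_gt0 phi_cvx
  phi_smooth Q_full rho_gt0 rho_ge K0.
have B1 : 0 < `|B| + 1 by rewrite ltr_wpDl.
have nc0 : 0 < nc%:R :> R by rewrite ltr0n.
(* The bound 1 makes [K0], and with it the radius [B], valid for [C]; the other bound, summed over
   the [nc] components, gives the curvature condition with the positive radius [|B| + 1]. *)
exists (Num.min 1 (mu_f / 2 / (nc%:R * (`|B| + 1)))).
  by rewrite lt_min ltr01 !divr_gt0// mulr_gt0.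
move=> C A L A_affine C_le x z w xs zs ws iter clu.
have C1 j : spectral_norm (C j) <= 1.
  by apply: le_trans (C_le j) _; rewrite ge_min lexx.
have C2 : (`|B| + 1) * \sum_j spectral_norm (C j) <= mu_f / 2.
  rewrite -ler_pdivlMl//.
  apply: (@le_trans _ _ (\sum_(j < nc) (mu_f / 2 / (nc%:R * (`|B| + 1))))).
    by apply: ler_sum => j _; apply: le_trans (C_le j) _; rewrite ge_min lexx orbT.
  rewrite sumr_const card_ord -mulr_natl invfM.
  rewrite le_eqVlt; apply/orP; left; apply/eqP; field.
  by rewrite !gt_eqF.
pose l k := iterate_lagr f phi Q rho d e C x z w k.
have lag_le k : l k.+1 <= K0.
  apply: le_trans (K0P C x z w C1 iter).
  exact: (iterate_lagr_le nc_gt0 mu_f_gt0 f_cvx f_smooth X_cvx mu_phi_gt0 phi_cvx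
    phi_smooth Q_full rho_gt0 rho_ge A_affine iter).
have dual k := iterate_dual_gradient mu_phi_gt0 phi_cvx phi_smooth iter k.
have B_le k := BP A (x k.+1) (z k.+1) (w k.+1) (dual k) (lag_le k).
have B_B1 : B <= `|B| + 1 by have := ler_norm B; lra.
have x_le k : enorm (x k.+1) <= `|B| + 1.
  by have [h _ _] := B_le k; exact: le_trans B_B1.
have w_le k : enorm (w k.+1) <= `|B| + 1.
  by have [_ _ h] := B_le k; exact: le_trans B_B1.
have [K K_gt0 gap] := iterate_gap nc_gt0 mu_f_gt0 f_cvx f_smooth X_cvx mu_phi_gt0
  phi_cvx phi_smooth Q_full rho_gt0 rho_ge A_affine iter x_le w_le C2.
have res := residual_gap nc_gt0 mu_f_gt0 f_cvx f_smooth X_cvx mu_phi_gt0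
  phi_cvx phi_smooth Q_full rho_gt0 rho_ge A_affine iter.
(* The descent holds from index 1 on, hence the shift by one. *)
have l_decr : {homo (fun k => l k.+1) : k m / (k <= m)%N >-> m <= k}.
  apply/nonincreasing_seqP => k; rewrite -subr_ge0.
  by apply: le_trans (res k); rewrite mulr_ge0 ?sqr_ge0// ltW.
have l_cvg : cvgn (fun k => l k.+1).
  apply: nonincreasing_is_cvgn => //.
  eexists => _ [k _ <-].
  exact: (lagr_lower_bound nc_gt0 mu_f_gt0 f_cvx mu_phi_gt0 phi_cvx
    phi_smooth Q_full rho_gt0 rho_ge A (x k.+1) (dual k)).
have {l_cvg}[ls l_cvg] := (iffLR (cvg_ex _)) l_cvg.
have l_ge k : ls <= l k.+1.
  rewrite -(cvg_lim _ l_cvg)//; apply: nonincreasing_cvgn_ge => //.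
  exact: cvgP l_cvg.
have diff_cvg : (fun k => l k.+1 - l k.+2) @ \oo --> 0.
  rewrite -(subrr ls); apply: cvgB => //.
  by have := l_cvg; rewrite -(cvg_shiftS (fun k => l k.+1)).
have x_cont : {for (xs, zs, ws), continuous (fun q : iterate_space => q.1.1)}.
  by apply: cvg_comp; exact: cvg_fst.
have z_cont : {for (xs, zs, ws), continuous (fun q : iterate_space => q.1.2)}.
  by apply: cvg_comp; [exact: cvg_fst|exact: cvg_snd].
have w_cont : {for (xs, zs, ws), continuous (fun q : iterate_space => q.2)}.
  exact: cvg_snd.
have A_cont : entrywise_continuous (fun q : iterate_space => A q.1.1) (xs, zs, ws).
  move=> j; rewrite (_ : (fun q => _) = fun q =>
      2^-1 * dot q.1.1 (C j *m q.1.1) + dot (d j) q.1.1 + e j); last first.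
    by apply/funext => q; rewrite mxE.
  have x_ent := continuous_entrywise x_cont.
  apply: continuousD; last exact: cst_continuous.
  apply: continuousD.
    apply: continuousM; first exact: cst_continuous.
    by apply: continuous_dot => //; exact: entrywise_continuous_mulmx.
  by apply: continuous_dot => // i; exact: cst_continuous.
have r_cont := entrywise_continuousD A_cont
  (entrywise_continuous_mulmx (M := Q) (continuous_entrywise z_cont)).
have r2_cont := continuous_enorm_sqr r_cont.
have L_cont : {for (xs, zs, ws), continuous (fun q =>
    lagr f phi Q rho A q.1.1 q.1.2 q.2)}.
  apply: continuousD; last by apply: continuousM => //; exact: cst_continuous.
  apply: continuousD; last first.
    by apply: continuous_dot => //; exact: continuous_entrywise.
  apply: continuousD.
    exact: (@continuous_comp _ _ _ _ f _ x_cont (@f_cont xs)).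
  exact: (@continuous_comp _ _ _ _ phi _ z_cont (@phi_cont zs)).
(* The squared residual is at most [rho^-1] times a consecutive decrease of the Lagrangian, which
   tends to 0. *)
have feas : A xs + Q *m zs = 0.
  apply/eqP; rewrite -enorm_eq0 -sqrf_eq0; apply/eqP.
  apply: (cluster_continuous_lim clu r2_cont).
  rewrite -(cvg_shiftn 2).
  apply: (@squeeze_cvgr _ _ _ _ (fun=> 0) (fun k => rho^-1 * (l k.+1 - l k.+2))).
  - near=> k; rewrite sqr_ge0 /= addn2 ler_pdivlMl//; exact: res.
  - exact: cvg_cst.
  - by rewrite -[X in _ --> X](mulr0 rho^-1); apply: cvgM => //; exact: cvg_cst.
have xsX : in_blocks X xs.
  move=> i.
  have x_cont_i := @continuous_comp _ _ _ _ (fun y => submxcol y i) _ x_cont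
    (@continuous_submxcol R n nb i xs).
  have h := cluster_continuous_closed clu x_cont_i (@X_closed i).
  apply: h.
  by exists 1%N => // -[//|k] _; exact: (iterate_in_blocks iter).
have lsE : lagr f phi Q rho A xs zs ws = ls.
  apply: (cluster_continuous_lim clu L_cont).
  by have := l_cvg; rewrite (cvg_shiftS l).
(* At a feasible point the multiplier and penalty terms vanish. *)
have {}lsE : f xs + phi zs = ls.
  by rewrite -lsE /lagr feas dot0r enorm0 expr0n mulr0 !addr0.
split.
  exists ((1 + K) / K); split; first by rewrite ltr_pdivlMr//; lra.
  (* The decay starts at index 1; the extra factor [(1 + K) / K] compensates for the shifted
     exponent. *)
  exists ((l 1%N - ls) * ((1 + K) / K)); exists 1%N => // -[//|k] _ /=.
  rewrite /L !auglag_in//; last exact: (iterate_in_blocks iter).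
  rewrite -EFinB lee_fin.
  have -> : lagr f phi Q rho A xs zs ws = ls.
    by rewrite -lsE /lagr feas dot0r enorm0 expr0n mulr0 !addr0.
  rewrite -/(l k.+1) ger0_norm; last by rewrite subr_ge0; exact: l_ge.
  have K1 : (1 + K) / K != 0 by rewrite gt_eqF// divr_gt0// addr_gt0.
  rewrite exprS invfM -mulrA mulVKf//.
  apply: (@geometric_decay _ (fun k => l k.+1 - ls)) => // m.
  (* At the limit point, whose value is [ls], the contraction inequality is the hypothesis of
     [geometric_decay] for [l k.+1 - ls]. *)
  have := gap m xs zs xsX feas; rewrite lsE -/(l m.+2) -/(l m.+1); lra.
split => //; first by rewrite composite_in// ltry.
(* The neighbourhood is the whole space, as the minimum is global. *)
exists (setT, setT); first by split; exact: filterT.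
move=> -[xb zb] _ /= feasb.
have [xbX|xbX] := pselect (in_blocks X xb); last first.
  have -> : composite f X xb = +oo%E.
    apply/eqP; rewrite -leye_eq leNgt; apply/negP => /composite_lty; exact: xbX.
  by rewrite addye// leey.
rewrite !composite_in// -!EFinD lee_fin lsE.
apply: (ler_cvg_to (f := fun k => l k.+2 - K * (l k.+1 - l k.+2))
  (g := fun=> f xb + phi zb) (a := \oo)).
- rewrite -[X in _ --> X]subr0 -[X in _ - X](mulr0 K); apply: cvgB.
    by have := l_cvg; rewrite -(cvg_shiftS (fun k => l k.+1)).
  by apply: cvgM => //; exact: cvg_cst.
- exact: cvg_cst.
- by near=> k; exact: gap.
Unshelve. all: by end_near.
Qed.

End LinearConvergence.

(** * Choice of the constants in the smallness condition on [C] *)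

Theorem theorem3p2 (R : realType) (n : nat) (nb : 'I_n -> nat) (nz nc : nat)
    (f : 'cV[R]_(\sum_i nb i) -> R) (X : forall i : 'I_n, set 'cV[R]_(nb i))
    (phi : 'cV[R]_nz -> R) (Q : 'M[R]_(nc, nz))
    (d : 'I_nc -> 'cV[R]_(\sum_i nb i)) (e : 'I_nc -> R)
    (mu_f L_f mu_phi L_phi rho : R)
    (x0 : 'cV[R]_(\sum_i nb i)) (z0 : 'cV[R]_nz) (w0 : 'cV[R]_nc) :
  (0 < nc)%N ->
  subanalytic (composite f X) ->
  C2 f -> 0 < mu_f -> strongly_convex mu_f f -> smooth L_f f ->
  (forall i, [/\ X i !=set0, closed (X i) & convex_set (X i)]) ->
  C2 phi -> 0 < mu_phi -> strongly_convex mu_phi phi -> smooth L_phi phi ->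
  \rank Q = nc ->
  0 < rho ->
  Num.max (4 * L_phi ^+ 2 / (mu_phi * lambda_min_pos (Q^T *m Q)))
          (4 * L_phi ^+ 2 / (mu_phi * Num.sqrt (lambda_min_pos (Q *m Q^T))))
    <= rho ->
  exists m1 m2 m3 : R, [/\ 0 < m1, 0 < m2 & 0 < m3] /\
  forall C : 'I_nc -> 'M[R]_(\sum_i nb i),
  let A := quadratic_op C d e in
  let L := auglag (composite f X) phi A Q rho in
  let P := invmx (Q *m Q^T) *m Q in
  multiaffine A ->
  \big[Num.max/0]_(i < nc) spectral_norm (C i) <=
    (spectral_norm P)^-1 *
    Num.min m1 (Num.min (m2 * lambda_min (Q *m Q^T) `^ (1 / 2))
      (m3 * lambda_min (Q *m Q^T) `^ (1 / 4) * spectral_norm P `^ (1 / 2))) ->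
  forall (x : nat -> 'cV[R]_(\sum_i nb i)) (z : nat -> 'cV[R]_nz)
         (w : nat -> 'cV[R]_nc)
         (xs : 'cV[R]_(\sum_i nb i)) (zs : 'cV[R]_nz) (ws : 'cV[R]_nc),
  admm_iterates (composite f X) phi A Q rho x0 z0 w0 x z w ->
  cluster ((fun k => (x k, z k, w k)) @ \oo) (xs, zs, ws) ->
  twice_differentiable_at (fun p => L p.1.1 p.1.2 p.2) (xs, zs, ws) ->
  (exists c1 : R, 1 < c1 /\
     exists M : R, \forall k \near \oo,
       (`|L (x k) (z k) (w k) - L xs zs ws| <= (M * c1 ^- k)%:E)%E) /\
  local_minimum (composite f X) phi A Q xs zs.
Proof.
move=> nc_gt0 _ f_C2 mu_f_gt0 f_cvx f_smooth X_hyp phi_C2 mu_phi_gt0 phi_cvx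
  phi_smooth Q_full rho_gt0 rho_ge.
have [f_diff _ _] := f_C2; have [phi_diff _ _] := phi_C2.
have {}rho_ge : 4 * L_phi ^+ 2 / (mu_phi * lambda_min_pos (Q^T *m Q)) <= rho.
  by apply: le_trans rho_ge; rewrite le_max lexx.
have [eps eps_gt0 conv] := admm_linear_convergence nc_gt0 mu_f_gt0
  (fun y => differentiable_continuous (f_diff y))
  (strongly_convex_gradient f_diff f_cvx) f_smooth
  (fun i => let: And3 h _ _ := X_hyp i in h)
  (fun i => let: And3 _ h _ := X_hyp i in h)
  (fun i => let: And3 _ _ h := X_hyp i in h) mu_phi_gt0
  (fun y => differentiable_continuous (phi_diff y))
  (strongly_convex_gradient phi_diff phi_cvx) phi_smooth Q_full rho_gt0 rho_ge
  d e x0 z0 w0.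
pose s := spectral_norm (invmx (Q *m Q^T) *m Q).
have s_ge0 : 0 <= s by exact: spectral_norm_ge0.
(* The minimum is at most [m1], and [s^-1 * (eps * s) = eps]; for [s = 0] the right-hand side is 0
   by the convention that 0 is its own inverse, so 1 serves as [m1]. *)
exists (if s == 0 then 1 else eps * s), 1, 1; split.
  by split => //; case: eqP => // /eqP s0; rewrite mulr_gt0// lt_neqAle eq_sym s0.
move=> C A L P A_affine C_le x z w xs zs ws iter clu _.
apply: (conv C) iter clu => // j.
apply: (le_trans (le_bigmax _ (fun i => spectral_norm (C i)) j)).
apply: (le_trans C_le); rewrite -/s.
apply: (@le_trans _ _ (s^-1 * (if s == 0 then 1 else eps * s))).
  by rewrite ler_wpM2l ?invr_ge0// ge_min lexx.
have [->|s0] := eqVneq s 0; first by rewrite invr0 mul0r ltW.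
by rewrite mulrCA mulVf ?mulr1.
Qed.
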